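(* Let $q$ be a prime power and let $\ell, m, n, k$ be positive integers with $1\le k\le n$, $\ell\le q-1$, and let $(n_1,\dots,n_\ell)$ be an ordered partition of $n$ (positive integers with $\sum_l n_l=n$). Let $Z_1,\dots,Z_k\subseteq[n]$. Suppose $q\ge \ell+1$ and $m\ge \max_{l\in[\ell]}\{k-1+\log_q k,\ n_l\}$. Then there exists an $[n,k]_{q^m}$ linearized Reed–Solomon code with $\ell$ blocks of lengths $n_1,\dots,n_\ell$ having a generator matrix $\boldsymbol G\in\mathbb F_{q^m}^{k\times n}$ with $G_{ij}=0$ for all $i\in[k]$ and all $j\in Z_i$ if and only if for every nonempty $\Omega\subseteq[k]$, $$\Big|\bigcap_{i\in\Omega}Z_i\Big|+|\Omega|\le k .$$
   Context: $[a]=\{1,\dots,a\}$. Let $\sigma:\mathbb F_{q^m}\to\mathbb F_{q^m}$, $\sigma(a)=a^q$. Two elements $a,b\in\mathbb F_{q^m}$ are $\sigma$-conjugate if $b=a c^{q-1}$ for some $c\in\mathbb F_{q^m}^*$; this is an equivalence relation whose classes partition $\mathbb F_{q^m}$ ($\{0\}$ plus $q-1$ classes of nonzero elements). For $a\in\mathbb F_{q^m}$ and $i\ge0$ let $N_i(a)=a^{(q^i-1)/(q-1)}$. Columns are indexed by pairs $(l,t)$, $l\in[\ell]$, $t\in[n_l]$, with column index $j=t+\sum_{r<l}n_r$. A linearized Reed–Solomon (LRS) code of dimension $k$ with blocks $(n_1,\dots,n_\ell)$ (requiring $n_l\le m$) is specified by block representatives $a_1,\dots,a_\ell\in\mathbb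 F_{q^m}^*$ lying in pairwise distinct $\sigma$-conjugacy classes and column multipliers $\beta_{l,1},\dots,\beta_{l,n_l}\in\mathbb F_{q^m}$ that are $\mathbb F_q$-linearly independent for each $l$; it is the $\mathbb F_{q^m}$-row space of the $k\times n$ matrix whose entry in row $i\in\{0,\dots,k-1\}$ and column $(l,t)$ is $N_i(a_l)\,\beta_{l,t}^{q^i}$. Equivalently, it is $\{(\beta_{l,t}\, f(a_l\beta_{l,t}^{q-1}))_{(l,t)} : f=\sum_{i<k} f_iX^i\}$ with $f(\alpha)=\sum_i f_iN_i(\alpha)$. *)

(* Defs.v *)
From HB Require Import structures.
From mathcomp Require Import all_boot all_order all_algebra all_field.
Set Implicit Arguments. Unset Strict Implicit. Unset Printing Implicit Defensive.
Import GRing.Theory.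
Local Open Scope ring_scope.

Definition prime_power (q : nat) : Prop :=
  exists p e : nat, prime p /\ (0 < e)%N /\ q = (p ^ e)%N.

(* sigma-conjugacy in F = F_{q^m}, sigma(a) = a^q : b = a c^(q-1), c <> 0 *)
Definition sigma_conj (F : fieldType) (q : nat) (a b : F) : Prop :=
  exists c : F, c != 0 /\ b = a * c ^+ (q - 1).

Definition Nq (F : fieldType) (q i : nat) (a : F) : F :=
  a ^+ ((q ^ i - 1) %/ (q - 1)).

(* column j (0-based) lies in block l (0-based) of the partition n_ *)
Definition in_block (ell : nat) (n_ : 'I_ell -> nat) (l : 'I_ell) (j : nat) : bool :=
  ((\sum_(r < ell | (r < l)%N) n_ r)%N <= j < (\sum_(r < ell | (r <= l)%N) n_ r)%N)%N.

(* elements of F_q inside F: the fixed points of sigma *)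
Definition in_Fq (F : fieldType) (q : nat) (c : F) : bool := c ^+ q == c.

Definition block_Fq_indep (F : fieldType) (q ell n : nat) (n_ : 'I_ell -> nat)
  (beta : 'I_n -> F) (l : 'I_ell) : Prop :=
  forall c : 'I_n -> F,
    (forall j : 'I_n, in_Fq q (c j)) ->
    \sum_(j < n | in_block n_ l j) c j * beta j = 0 ->
    forall j : 'I_n, in_block n_ l j -> c j = 0.

(* the k x n matrix with entry N_i(a_l) beta_{l,t}^{q^i} in row i, column (l,t);
   for a partition exactly one block contains j *)
Definition LRS_matrix (F : fieldType) (q k ell n : nat) (n_ : 'I_ell -> nat)
  (a : 'I_ell -> F) (beta : 'I_n -> F) : 'M[F]_(k, n) :=
  \matrix_(i < k, j < n)
    \sum_(l < ell | in_block n_ l j) Nq q i (a l) * beta j ^+ (q ^ i).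

Definition LRS_params (F : fieldType) (q ell n : nat) (n_ : 'I_ell -> nat)
  (a : 'I_ell -> F) (beta : 'I_n -> F) : Prop :=
  (forall l, a l != 0) /\
  (forall l l', l != l' -> ~ sigma_conj q (a l) (a l')) /\
  (forall l, block_Fq_indep q n_ beta l).

Definition generator_of (F : fieldType) (k n : nat) (G M : 'M[F]_(k, n)) : bool :=
  row_free G && (G == M)%MS.

(* Main.v *)
(** Write [S] for left multiplication by [X] in the skew polynomial ring with
[X c = c^q X]. A codeword is the list of values at the points [(a_l, beta)] of a
skew polynomial of degree less than [k], and a nonzero one of degree [d] vanishes
on at most [d] points of a valid evaluation set (divide on the right by
[X - a beta^(q-1)]). This gives the necessity of the condition.

For sufficiency, enlarge the [Z_i] until each has [k - 1] elements, keeping the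
condition, and let row [i] of the generator matrix be the monic annihilator [f_i] of
the points indexed by [Z_i]. It remains to make the [f_i] linearly independent.
Over the algebraic closure this is shown for generic points, for the more general
families [S^(t_i + e) f_i] with [e < d_i]. A tight proper subfamily is merged into one
member; if at most one [t_i] is zero, a factor [X] is cancelled; otherwise some point
is sent to [0], where the annihilator acquires a left factor [X]. Finally the points
are moved one at a time into the finite field: the determinant has degree at most
[(k - 1) (q - 1) q^(k-2)] in each point, and at most [q^(m-1)] values depend linearly on
the earlier points of the block. *)

Require Import Defs.
From HB Require Import structures.
From mathcomp Require Import all_boot all_order all_algebra all_field.
From mathcomp Require Import cyclic ring zify.
Set Implicit Arguments. Unset Strict Implicit. Unset Printing Implicit Defensive.
Import GRing.Theory.
Local Open Scope ring_scope.

(** * Skew polynomials and their values at semilinear maps *)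

Section SkewPolynomials.
Variables (K : fieldType) (q : nat) (phi : {rmorphism K -> K}).
Hypothesis phiE : forall x, phi x = x ^+ q.
Hypothesis q_gt1 : (1 < q)%N.

(* The skew polynomial with left coefficients [p_i] is stored as the ordinary
   polynomial [p]; the product of [{poly K}] is not the skew product. *)
Definition skewX (p : {poly K}) : {poly K} := 'X * map_poly phi p.

(** The iterates of [semi a] at [y] are $N_i(a) y^{q^i}$, so [skew_eval a p y] below is the codeword
    entry $y f(a y^{q-1})$, in a form visibly additive in [y]. *)
Definition semi (a y : K) : K := a * phi y.

Definition skew_eval (a : K) (p : {poly K}) (y : K) : K :=
  \sum_(i < size p) p`_i * iter i (semi a) y.

Lemma skew_eval_widen a (p : {poly K}) y N : (size p <= N)%N ->
  skew_eval a p y = \sum_(i < N) p`_i * iter i (semi a) y.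
Proof.
move=> le; rewrite /skew_eval (big_ord_widen N (fun i => p`_i * iter i (semi a) y) le).
rewrite big_mkcond /=; apply: eq_bigr => i _; case: ltnP => // H.
by rewrite nth_default // mul0r.
Qed.

Lemma skew_evalD a p r y : skew_eval a (p + r) y = skew_eval a p y + skew_eval a r y.
Proof.
pose N := maxn (size p) (size r).
rewrite !(@skew_eval_widen a _ y N) ?leq_maxl ?leq_maxr ?size_polyD //.
by rewrite -big_split; apply: eq_bigr => i _; rewrite coefD mulrDl.
Qed.

Lemma skew_evalZ a c p y : skew_eval a (c *: p) y = c * skew_eval a p y.
Proof.
rewrite (@skew_eval_widen a _ y (size p)) ?size_scale_leq // /skew_eval mulr_sumr.
by apply: eq_bigr => i _; rewrite coefZ mulrA.
Qed.

Lemma skew_evalB a p r y : skew_eval a (p - r) y = skew_eval a p y - skew_eval a r y.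
Proof. by rewrite -scaleN1r skew_evalD skew_evalZ mulN1r. Qed.

Lemma semiD a : {morph semi a : x y / x + y}.
Proof. by move=> x y; rewrite /semi rmorphD mulrDr. Qed.

Lemma semi_iterD a i : {morph iter i (semi a) : x y / x + y}.
Proof. by move=> x y; elim: i => //= i ->; rewrite semiD. Qed.

Lemma semi0 a : semi a 0 = 0.
Proof. by rewrite /semi rmorph0 mulr0. Qed.

Lemma semi_iter0 a i : iter i (semi a) 0 = 0.
Proof. by elim: i => //= i ->; rewrite semi0. Qed.

Lemma semi_iterZ a i c y : phi c = c -> iter i (semi a) (c * y) = c * iter i (semi a) y.
Proof. by move=> Hc; elim: i => //= i ->; rewrite /semi rmorphM Hc mulrCA. Qed.

Lemma semi_iterE a i y :
  iter i (semi a) y = iter i (semi a) 1 * y ^+ (q ^ i).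
Proof.
elim: i => [|i IH] /=; first by rewrite mul1r.
by rewrite {1}IH /semi rmorphM (phiE (y ^+ _)) -exprM -expnSr mulrA.
Qed.

Lemma skew_eval_addr a p x y :
  skew_eval a p (x + y) = skew_eval a p x + skew_eval a p y.
Proof. by rewrite -big_split; apply: eq_bigr => i _; rewrite semi_iterD mulrDr. Qed.

Lemma skew_eval0r a p : skew_eval a p 0 = 0.
Proof. by rewrite /skew_eval big1 // => i _; rewrite semi_iter0 mulr0. Qed.

Lemma skew_eval_scaler a p c y : phi c = c -> skew_eval a p (c * y) = c * skew_eval a p y.
Proof.
move=> Hc; rewrite /skew_eval mulr_sumr; apply: eq_bigr => i _.
by rewrite semi_iterZ // mulrCA.
Qed.

Lemma skewXB : {morph skewX : p r / p - r}.
Proof. by move=> p r; rewrite /skewX rmorphB mulrBr. Qed.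

Lemma skewXZ c p : skewX (c *: p) = phi c *: skewX p.
Proof. by rewrite /skewX map_polyZ scalerAr. Qed.

Lemma skewX_sum (J : Type) (r : seq J) (P : pred J) (f : J -> {poly K}) :
  skewX (\sum_(i <- r | P i) f i) = \sum_(i <- r | P i) skewX (f i).
Proof. by rewrite /skewX rmorph_sum mulr_sumr. Qed.

Lemma coef_skewX p i : (skewX p)`_i = if i is i'.+1 then phi p`_i' else 0.
Proof. by rewrite /skewX coefXM; case: i => //= i; rewrite coef_map. Qed.

Lemma size_skewX p : size (skewX p) = if p == 0 then 0%N else (size p).+1.
Proof.
rewrite /skewX; case: eqP => [->|/eqP nz]; first by rewrite rmorph0 mulr0 size_poly0.
by rewrite mulrC size_mulX ?map_poly_eq0 // size_map_poly.
Qed.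

Lemma size_skewX_leq p : (size (skewX p) <= (size p).+1)%N.
Proof. by rewrite size_skewX; case: ifP. Qed.

Lemma skewX_monic p : p \is monic -> skewX p \is monic.
Proof. by move=> Hp; rewrite /skewX rpredM ?monicX ?map_monic. Qed.

Lemma skew_evalX a p y : skew_eval a (skewX p) y = semi a (skew_eval a p y).
Proof.
rewrite (@skew_eval_widen a _ y (size p).+1) ?size_skewX_leq //.
rewrite big_ord_recl coef_skewX mul0r add0r /skew_eval.
rewrite /semi rmorph_sum mulr_sumr; apply: eq_bigr => i _.
by rewrite coef_skewX /= rmorphM mulrCA.
Qed.

(** * Annihilator polynomials *)

Variables (I : eqType) (alpha : I -> K).

(* Multiplying [f] on the left by [X - b], with [b = alpha_j f(g_j)^(q-1)], kills the
   value at [g_j]; when that value is already [0], the factor is [X]. *)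
Fixpoint annih (g : I -> K) (s : seq I) : {poly K} :=
  if s is j :: s' then
    skewX (annih g s')
      - (alpha j * skew_eval (alpha j) (annih g s') (g j) ^+ (q - 1)) *: annih g s'
  else 1.

Lemma exprq1 (x : K) : x ^+ q = x * x ^+ (q - 1).
Proof. by rewrite -exprS subn1 prednK // ltnW. Qed.

Lemma annih_monic_size g s :
  (annih g s \is monic) * (size (annih g s) = (size s).+1).
Proof.
elim: s => [|j s [mn sz]] /=; first by rewrite monic1 size_poly1.
have szX : size (skewX (annih g s)) = (size s).+2.
  by rewrite size_skewX (negPf (monic_neq0 mn)) sz.
have lt : (size (- ((alpha j * skew_eval (alpha j) (annih g s) (g j) ^+ (q - 1)) *: annih g s)) < size (skewX (annih g s)))%N.
  by rewrite size_polyN szX ltnS (leq_trans (size_scale_leq _ _)) ?sz.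
split; last by rewrite size_polyDl.
by rewrite monicE lead_coefDl // -monicE skewX_monic.
Qed.

Lemma size_annih g s : size (annih g s) = (size s).+1.
Proof. exact: (annih_monic_size g s).2. Qed.

Lemma annih_monic g s : annih g s \is monic.
Proof. exact: (annih_monic_size g s).1. Qed.

Lemma eq_annih g g' s : {in s, g =1 g'} -> annih g s = annih g' s.
Proof.
elim: s => //= j s IH H; rewrite IH ?H ?mem_head //.
by move=> i Hi; apply: H; rewrite inE Hi orbT.
Qed.

(** Since $0^{q-1} = 0$ for $q > 1$, a point sent to 0 contributes exactly the left factor $X$. The
    specialization step below rests on this. *)
Lemma annih0 g j s : g j = 0 -> annih g (j :: s) = skewX (annih g s).
Proof.
move=> /= ->; rewrite skew_eval0r expr0n subn_eq0 leqNgt q_gt1.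
by rewrite mulr0 scale0r subr0.
Qed.

Lemma exprqB (x y : K) : (x - y) ^+ q = x ^+ q - y ^+ q.
Proof. by rewrite -!phiE rmorphB. Qed.

(** Reading it off from $\sigma(-1) = -1$ treats odd and even $q$ at once. *)
Lemma signq1 : (-1) ^+ (q - 1) = 1 :> K.
Proof.
have : (-1) ^+ q = -1 :> K by rewrite -phiE rmorphN rmorph1.
by rewrite exprq1 mulN1r => /oppr_inj.
Qed.

(* With [A = a u^(q-1)] and [B = b v^(q-1)], where [u] and [v] are the values of
   the annihilator of [s], the new coefficients are [B^q + A (A - B)^(q-1)] and
   [A B (A - B)^(q-1)], both symmetric in [A] and [B]. *)
Lemma annih_swap g i j s : annih g (i :: j :: s) = annih g (j :: i :: s).
Proof.
rewrite /=; set f := annih g s.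
set u := skew_eval (alpha i) f (g i); set v := skew_eval (alpha j) f (g j).
rewrite !skew_evalB !skew_evalZ !skew_evalX -/u -/v /semi !phiE.
set A := alpha i * u ^+ (q - 1); set B := alpha j * v ^+ (q - 1).
have E1 : alpha i * u ^+ q = A * u by rewrite exprq1 /A mulrCA mulrC.
have E2 : alpha j * v ^+ q = B * v by rewrite exprq1 /B mulrCA mulrC.
rewrite E1 E2 -!mulrBl !exprMn.
rewrite !mulrA (mulrAC (alpha i)) (mulrAC (alpha j)) -/A -/B.
rewrite !skewXB !skewXZ !phiE.
have sg : (B - A) ^+ (q - 1) = (A - B) ^+ (q - 1).
  by rewrite -opprB -mulN1r exprMn signq1 mul1r.
have sm : B ^+ q + A * (A - B) ^+ (q - 1) = A ^+ q + B * (A - B) ^+ (q - 1).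
  have := exprqB A B; rewrite exprq1; set w := _ ^+ _.
  move=> E; have -> : A * w = (A - B) * w + B * w by ring.
  by rewrite E; ring.
rewrite sg; move: sm; set w := (A - B) ^+ _ => sm.
rewrite !scalerBr !scalerA !opprB.
rewrite (_ : A * w * B = B * w * A); last by ring.
rewrite !addrA -!(addrAC _ _ (_ *: f)); congr (_ + _).
rewrite -!addrA; congr (_ + _).
by rewrite -!scaleNr -!scalerDl -!opprD sm.
Qed.

Lemma annih_move g j t s : annih g (t ++ j :: s) = annih g (j :: t ++ s).
Proof. by elim: t => // i t IH; rewrite annih_swap /= IH. Qed.

Lemma perm_annih g s t : perm_eq s t -> annih g s = annih g t.
Proof.
elim: s t => [|j s IH] t.
  by rewrite perm_sym => /perm_nilP->.
move=> H; have := mem_head j s; rewrite (perm_mem H) => /splitPr Ht.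
case: Ht H => t1 t2; rewrite annih_move perm_sym perm_catC /= perm_cons perm_catC => H.
by rewrite /= (IH (t1 ++ t2)) // perm_sym.
Qed.

Lemma annih_root g s j : j \in s -> skew_eval (alpha j) (annih g s) (g j) = 0.
Proof.
elim: s => //= i s IH; rewrite inE skew_evalB skew_evalX skew_evalZ.
case: eqP => [->|_] /=; last by move/IH->; rewrite semi0 mulr0 subrr.
by move=> _; rewrite /semi phiE exprq1; ring.
Qed.

(** The points of [t] come first and give linear factors on the left, so $X^x$ times the annihilator
    of [t ++ s] is a left multiple of the annihilator of [s]; [c] lists the left coefficients of the
    multiplier, of degree at most [x + size t]. *)
Lemma annih_cat_span g t s x : exists c : nat -> K,
  iter x skewX (annih g (t ++ s)) =
  \sum_(e < (x + size t).+1) c e *: iter e skewX (annih g s).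
Proof.
elim: x => [|x [c Hc]]; last first.
  exists (fun e => if e is e'.+1 then phi (c e') else 0).
  rewrite addSn big_ord_recl /= scale0r add0r Hc skewX_sum.
  by apply: eq_bigr => i _; rewrite skewXZ.
elim: t => [|j t [c Hc]] /=.
  by exists (fun => 1); rewrite big_ord1 scale1r.
move: Hc; rewrite /= !add0n => ->; set f := annih g s; set b := _ * _ ^+ _.
exists (fun e => (if e is e'.+1 then phi (c e') else 0)
   - (if (e < (size t).+1)%N then b * c e else 0)).
under [RHS]eq_bigr do rewrite scalerBl.
rewrite sumrB; congr (_ - _).
  rewrite [RHS]big_ord_recl /= scale0r add0r skewX_sum.
  by apply: eq_bigr => i _; rewrite skewXZ.
rewrite scaler_sumr [RHS]big_ord_recr /= ltnn scale0r addr0.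
by apply: eq_bigr => i _; rewrite scalerA ltn_ord.
Qed.

End SkewPolynomials.

(** * Generic position *)

Section PolynomialFunctions.
Variables (K : fieldType) (I : finType).

Definition line (g d : I -> K) (t : K) : I -> K := fun j => g j + t * d j.

(* Only the restriction to lines matters: two conditions that can each be
   satisfied are satisfied together somewhere on the line joining two witnesses. *)
Definition poly_on_lines (P : (I -> K) -> K) : Prop :=
  forall g d, exists h : {poly K}, forall t g', g' =1 line g d t -> P g' = h.[t].

Lemma pol_cst c : poly_on_lines (fun=> c).
Proof. by move=> g d; exists c%:P => t g' _; rewrite hornerC. Qed.

Lemma pol_var j : poly_on_lines (fun g => g j).
Proof.
move=> g d; exists ((g j)%:P + 'X * (d j)%:P) => t g' ->.
by rewrite !hornerE.
Qed.

Lemma eq_pol P Q : P =1 Q -> poly_on_lines P -> poly_on_lines Q.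
Proof. by move=> E HP g d; have [h Hh] := HP g d; exists h => t g'; rewrite -E; apply: Hh. Qed.

Lemma polD P Q : poly_on_lines P -> poly_on_lines Q ->
  poly_on_lines (fun g => P g + Q g).
Proof.
move=> HP HQ g d; have [h Hh] := HP g d; have [h' Hh'] := HQ g d.
by exists (h + h') => t g' E; rewrite (Hh _ _ E) (Hh' _ _ E) hornerD.
Qed.

Lemma polM P Q : poly_on_lines P -> poly_on_lines Q ->
  poly_on_lines (fun g => P g * Q g).
Proof.
move=> HP HQ g d; have [h Hh] := HP g d; have [h' Hh'] := HQ g d.
by exists (h * h') => t g' E; rewrite (Hh _ _ E) (Hh' _ _ E) hornerM.
Qed.

Lemma polX P n : poly_on_lines P -> poly_on_lines (fun g => P g ^+ n).
Proof.
move=> HP; elim: n => [|n IH]; first exact: pol_cst.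
by apply: eq_pol (polM HP IH) => g; rewrite exprS.
Qed.

Lemma pol_sum (X : Type) (r : seq X) (C : pred X) (P : X -> (I -> K) -> K) :
  (forall x, poly_on_lines (P x)) -> poly_on_lines (fun g => \sum_(x <- r | C x) P x g).
Proof.
move=> HP; elim: r => [|x r IH].
  by apply: eq_pol (pol_cst 0) => g; rewrite big_nil.
case Cx: (C x); last by apply: eq_pol IH => g; rewrite big_cons Cx.
by apply: eq_pol (polD (HP x) IH) => g; rewrite big_cons Cx.
Qed.

Lemma pol_prod (X : Type) (r : seq X) (C : pred X) (P : X -> (I -> K) -> K) :
  (forall x, poly_on_lines (P x)) -> poly_on_lines (fun g => \prod_(x <- r | C x) P x g).
Proof.
move=> HP; elim: r => [|x r IH].
  by apply: eq_pol (pol_cst 1) => g; rewrite big_nil.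
case Cx: (C x); last by apply: eq_pol IH => g; rewrite big_cons Cx.
by apply: eq_pol (polM (HP x) IH) => g; rewrite big_cons Cx.
Qed.

Lemma pol_det n (M : (I -> K) -> 'M[K]_n) :
  (forall i j, poly_on_lines (fun g => M g i j)) -> poly_on_lines (fun g => \det (M g)).
Proof.
move=> HM; apply: pol_sum => s; apply: polM; first exact: pol_cst.
by apply: pol_prod => i; apply: HM.
Qed.

(** [Q] contains a nonempty set of the form $P \neq 0$, which plays the role of a nonempty Zariski
    open set. *)
Definition generically (Q : (I -> K) -> Prop) : Prop :=
  exists P, [/\ poly_on_lines P, exists g, P g != 0 & forall g, P g != 0 -> Q g].

Lemma generically_ex Q : generically Q -> exists g, Q g.
Proof. by case=> P [_ [g Hg] HQ]; exists g; apply: HQ. Qed.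

Lemma generically_imp (Q Q' : (I -> K) -> Prop) :
  (forall g, Q g -> Q' g) -> generically Q -> generically Q'.
Proof. by move=> H [P [HP ex HQ]]; exists P; split=> // g /HQ /H. Qed.

Lemma generically_true (Q : (I -> K) -> Prop) : (forall g, Q g) -> generically Q.
Proof.
move=> H; exists (fun=> 1); split=> //; first exact: pol_cst.
by exists (fun=> 0); apply: oner_neq0.
Qed.

Definition infinite_field := forall h : {poly K}, h != 0 -> exists x, h.[x] != 0.

Lemma generically_and Q Q' : infinite_field ->
  generically Q -> generically Q' -> generically (fun g => Q g /\ Q' g).
Proof.
move=> Kinf [P [HP [g Pg] PQ]] [P' [HP' [g' Pg'] PQ']].
exists (fun x => P x * P' x); split; first exact: polM.
  pose d j := g' j - g j.
  have [h Hh] := HP g d; have [h' Hh'] := HP' g d.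
  have nz : h != 0.
    apply: contraNneq Pg => h0; rewrite (Hh 0 g) ?h0 ?horner0 //.
    by move=> j; rewrite /line mul0r addr0.
  have nz' : h' != 0.
    apply: contraNneq Pg' => h0; rewrite (Hh' 1 g') ?h0 ?horner0 //.
    by move=> j; rewrite /line mul1r /d addrC subrK.
  have [t Ht] := Kinf _ (mulf_neq0 nz nz').
  by exists (line g d t); rewrite (Hh t) // (Hh' t) // -hornerM.
by move=> x; rewrite mulf_eq0 negb_or => /andP[/PQ ? /PQ'].
Qed.

Definition indep (X : finType) (A : {set X}) (f : X -> {poly K}) : Prop :=
  forall c : X -> K, \sum_(x in A) c x *: f x = 0 -> forall x, x \in A -> c x = 0.

Definition coef_mx (X : finType) (A : {set X}) N (f : X -> {poly K}) : 'M[K]_(#|A|, N) :=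
  \matrix_(r, i) (f (enum_val r))`_i.

Lemma indepP (X : finType) (A : {set X}) N (f : X -> {poly K}) :
  (forall x, x \in A -> (size (f x) <= N)%N) ->
  indep A f <-> row_free (coef_mx A N f).
Proof.
move=> szf.
have sumE c : \sum_(x in A) c x *: f x = \sum_(r < #|A|) c (enum_val r) *: f (enum_val r).
  by rewrite big_enum_val.
have mulE (v : 'rV_ #|A|) i : (v *m coef_mx A N f) 0 i =
    (\sum_(r < #|A|) v 0 r *: f (enum_val r))`_i.
  by rewrite mxE coef_sum; apply: eq_bigr => r _; rewrite mxE coefZ.
split=> [Hind|Hfree c Hc x xA].
  apply: inj_row_free => v Hv.
  pose c x := \sum_(r < #|A|) v 0 r *+ (enum_val r == x).
  have cE r : c (enum_val r) = v 0 r.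
    rewrite /c (bigD1 r) //= eqxx big1 ?addr0 // => s /negPf ns.
    by rewrite (inj_eq enum_val_inj) ns.
  have {}Hv : \sum_(x in A) c x *: f x = 0.
    rewrite sumE; under eq_bigr do rewrite cE.
    apply/polyP => i; rewrite coef0; case: (ltnP i N) => [iN|Ni].
      by rewrite -(mulE v (Ordinal iN)) Hv mxE.
    rewrite coef_sum big1 // => r _; rewrite coefZ nth_default ?mulr0 //.
    exact: leq_trans (szf _ (enum_valP r)) Ni.
  apply/rowP => r; rewrite mxE -cE; apply: Hind Hv _ _; exact: enum_valP.
have : (\row_r c (enum_val r)) *m coef_mx A N f = 0.
  apply/rowP => i; rewrite mulE mxE.
  under eq_bigr do rewrite mxE.
  by rewrite -sumE Hc coef0.
move/eqP; rewrite mulmx_free_eq0 // => /eqP/rowP/(_ (enum_rank_in xA x)).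
by rewrite !mxE enum_rankK_in.
Qed.

(** Instead of choosing a nonzero minor, fix a right inverse [B] of the coefficient matrix at the
    witness: the determinant of the matrix times [B] is 1 there, and wherever it is nonzero the rows
    are independent. *)
Lemma generically_indep (X : finType) (A : {set X}) N (G : (I -> K) -> X -> {poly K}) :
  (forall x i, poly_on_lines (fun g => (G g x)`_i)) ->
  (forall g x, x \in A -> (size (G g x) <= N)%N) ->
  (exists g, indep A (G g)) -> generically (fun g => indep A (G g)).
Proof.
move=> HG szG [g0 /(indepP (szG g0)) /row_freeP[B HB]].
exists (fun g => \det (coef_mx A N (G g) *m B)); split.
- apply: pol_det => i j.
  apply: eq_pol (pol_sum (index_enum 'I_N) predT
    (P := fun l g => (G g (enum_val i))`_l * B l j) _) => [g|l].
    by rewrite mxE; apply: eq_bigr => l _; rewrite mxE.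
  by apply: polM (pol_cst _); apply: HG.
- by exists g0; rewrite HB det1 oner_neq0.
move=> g; rewrite -unitfE -/(_ \in unitmx) => U.
apply/(indepP (szG g)); apply/row_freeP.
by exists (B *m invmx (coef_mx A N (G g) *m B)); rewrite mulmxA mulmxV.
Qed.

End PolynomialFunctions.

(** * Annihilators as functions of the points *)

Section GenericAnnihilators.
Variables (K : fieldType) (q : nat) (phi : {rmorphism K -> K}).
Hypothesis phiE : forall x, phi x = x ^+ q.
Hypothesis q_gt1 : (1 < q)%N.
Hypothesis Kinf : infinite_field K.
Variables (I : finType) (alpha : I -> K).
Hypothesis alpha_neq0 : forall j, alpha j != 0.

Local Notation S := (skewX phi).
Local Notation ev := (skew_eval phi).
Local Notation ann := (annih q phi alpha).

(** The linearized polynomial whose ordinary values in [y] are [skew_eval a p y]; it allows root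
    counting by degree. *)
Definition eval_poly (a : K) (p : {poly K}) : {poly K} :=
  \sum_(i < size p) (p`_i * iter i (semi phi a) 1) *: 'X^(q ^ i).

Lemma eval_polyE a p y : (eval_poly a p).[y] = ev a p y.
Proof.
rewrite horner_sum; apply: eq_bigr => i _.
by rewrite hornerZ hornerXn (semi_iterE phiE _ _ y) mulrA.
Qed.

Lemma size_eval_poly_leq a p : (size (eval_poly a p) <= (q ^ (size p).-1).+1)%N.
Proof.
apply: (leq_trans (size_sum _ _ _)); apply/bigmax_leqP => i _.
apply: (leq_trans (size_scale_leq _ _)); rewrite size_polyXn ltnS.
by rewrite leq_exp2l // -ltnS prednK ?ltn_ord // (leq_ltn_trans _ (ltn_ord i)).
Qed.

Lemma semi_iter1_neq0 a i : a != 0 -> iter i (semi phi a) 1 != 0.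
Proof.
move=> a0; elim: i => [|i IH] /=; first exact: oner_neq0.
by rewrite /semi mulf_neq0 ?fmorph_eq0.
Qed.

Lemma eval_poly_neq0 a p : a != 0 -> p != 0 -> eval_poly a p != 0.
Proof.
(* The exponents $q^i$ are distinct, so only the leading term of [p] reaches this coefficient. *)
move=> a0 p0; apply/eqP => /polyP/(_ (q ^ (size p).-1)%N).
have sp : (0 < size p)%N by rewrite size_poly_gt0.
have lt : ((size p).-1 < size p)%N by rewrite prednK.
rewrite coef0 coef_sum (bigD1 (Ordinal lt)) //= coefZ coefXn eqxx mulr1 big1 ?addr0.
  by apply/eqP; rewrite mulf_neq0 ?semi_iter1_neq0 // -lead_coefE lead_coef_eq0.
move=> i /negPf ni; rewrite coefZ coefXn eqn_exp2l //.
by move: ni; rewrite -val_eqE /= eq_sym => ->; rewrite mulr0.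
Qed.

Lemma pol_ev a (f : (I -> K) -> {poly K}) j N :
  (forall i, poly_on_lines (fun g => (f g)`_i)) ->
  (forall g, size (f g) <= N)%N -> poly_on_lines (fun g => ev a (f g) (g j)).
Proof.
move=> Hf szf.
apply: eq_pol (pol_sum (index_enum 'I_N) predT
    (P := fun l g => (f g)`_l * (iter l (semi phi a) 1 * g j ^+ (q ^ l))) _) => [g|l].
  rewrite (skew_eval_widen phi a _ (szf g)).
  by apply: eq_bigr => i _; rewrite (semi_iterE phiE _ _ (g j)).
apply: polM (Hf _) _; apply: polM (pol_cst _) _; exact/polX/pol_var.
Qed.

Lemma pol_skewX (f : (I -> K) -> {poly K}) :
  (forall i, poly_on_lines (fun g => (f g)`_i)) ->
  forall i, poly_on_lines (fun g => (S (f g))`_i).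
Proof.
move=> Hf [|i].
  by apply: eq_pol (pol_cst 0) => g; rewrite coef_skewX.
by apply: eq_pol (polX q (Hf i)) => g; rewrite coef_skewX phiE.
Qed.

Lemma pol_annih s i : poly_on_lines (fun g => (ann g s)`_i).
Proof.
elim: s i => [|j s IH] i /=; first exact: pol_cst.
apply: eq_pol (polD (pol_skewX IH i)
   (polM (polM (pol_cst (- alpha j)) (polX (q - 1) (pol_ev (N := (size s).+1) (alpha j) j IH _))) (IH i))) => g.
  by rewrite coefB coefZ !mulNr.
by rewrite size_annih.
Qed.

Lemma size_iter_skewX e p : (size (iter e S p) <= size p + e)%N.
Proof.
elim: e => [|e IH] /=; first by rewrite addn0.
by rewrite addnS (leq_trans (size_skewX_leq _ _)).
Qed.

Lemma pol_iter_skewX e (f : (I -> K) -> {poly K}) :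
  (forall i, poly_on_lines (fun g => (f g)`_i)) ->
  forall i, poly_on_lines (fun g => (iter e S (f g))`_i).
Proof. by move=> Hf; elim: e => //= e IH; apply: pol_skewX. Qed.

(** Adding [j] multiplies the constant coefficient by $-\alpha_j v^{q-1}$, with $v$ the value of the
    old annihilator at $g_j$. As [j] is not in [s], the point $g_j$ can be moved off the roots
    without changing that annihilator. *)
Lemma generically_annih_coef0 s : uniq s -> generically (fun g => (ann g s)`_0 != 0).
Proof.
move=> Us; exists (fun g => (ann g s)`_0); split=> //; first exact: pol_annih.
elim: s Us => [|j s IH] /=; first by exists (fun=> 0); rewrite coef1 oner_neq0.
case/andP=> js /IH[g Hg].
have nz : eval_poly (alpha j) (ann g s) != 0.
  by rewrite eval_poly_neq0 // monic_neq0 // annih_monic.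
have [y Hy] := Kinf nz.
pose g' i := if i == j then y else g i.
have E : ann g' s = ann g s.
  apply: eq_annih => i; rewrite /g'; case: eqP => // ->.
  by rewrite (negPf js).
exists g'; rewrite E coefB coef_skewX sub0r oppr_eq0 coefZ mulf_neq0 // mulf_neq0 //.
by rewrite expf_neq0 // -eval_polyE /g' eqxx.
Qed.

End GenericAnnihilators.

(** * Generic independence of shifted annihilators *)

Section GenericIndependence.
Variables (K : fieldType) (q : nat) (phi : {rmorphism K -> K}).
Hypothesis phiE : forall x, phi x = x ^+ q.
Hypothesis q_gt1 : (1 < q)%N.
Hypothesis Kinf : infinite_field K.
Variable psi : K -> K.
Hypothesis psiK : cancel psi phi.
Variables (I T : finType) (alpha : I -> K).
Hypothesis alpha_neq0 : forall j, alpha j != 0.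

Local Notation S := (skewX phi).
Local Notation ann := (annih q phi alpha).

(** With [f] taken as [shifted] below, member [i] stands for the left multiples of $X^{t_i} f_i$ by
    polynomials of degree less than $d_i$; the claim is that these spaces are in direct sum, of full
    dimension. *)
Definition shifts_indep (J : {set T}) (d : T -> nat) (f : T -> nat -> {poly K}) : Prop :=
  forall c : T -> nat -> K,
    \sum_(i in J) \sum_(e < d i) c i e *: f i e = 0 ->
    forall i e, i \in J -> (e < d i)%N -> c i e = 0.

Definition shifted (Z : T -> {set I}) (t : T -> nat) (g : I -> K) (i : T) (e : nat) :=
  iter (t i + e) S (ann g (enum (Z i))).

Lemma shifts_indepP (J : {set T}) (d : T -> nat) (f : T -> nat -> {poly K}) N : (forall i, i \in J -> (d i <= N)%N) ->
  shifts_indep J d f <->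
  indep [set x : T * 'I_N | (x.1 \in J) && (x.2 < d x.1)%N] (fun x => f x.1 x.2).
Proof.
move=> dN; set A := [set x | _].
have sumE (c : T -> nat -> K) : \sum_(i in J) \sum_(e < d i) c i e *: f i e =
    \sum_(x in A) c x.1 x.2 *: f x.1 x.2.
  transitivity (\sum_(i in J) \sum_(e < N | (e < d i)%N) c i e *: f i e).
    apply: eq_bigr => i iJ.
    by rewrite (big_ord_widen N (fun e => c i e *: f i e)) ?dN.
  by rewrite pair_big_dep /=; apply: eq_bigl => x; rewrite inE.
split=> H c Hc.
  case=> i e; rewrite inE /= => /andP[iJ ed].
  (* Coefficients on the finite index type are extended by 0 to all natural [e]. *)
  pose c' i (e : nat) := if insub e is Some e' then c (i, e') else 0.
  have cE x : c' x.1 (val x.2) = c x by case: x => i' e' /=; rewrite /c' valK.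
  rewrite -cE /=; apply: H => //; rewrite sumE -[RHS]Hc.
  by apply: eq_bigr => x _; rewrite -cE.
move=> i e iJ ed; have eN := leq_trans ed (dN i iJ).
have := H (fun x => c x.1 x.2) _ (i, Ordinal eN); rewrite -sumE /= inE /= iJ ed.
by apply.
Qed.

Lemma generically_shifts_indep (J : {set T}) (d : T -> nat) Z t :
  (exists g, shifts_indep J d (shifted Z t g)) ->
  generically (fun g => shifts_indep J d (shifted Z t g)).
Proof.
pose N := (\max_(i in J) d i)%N.
have dN i : i \in J -> (d i <= N)%N by move=> iJ; apply: leq_bigmax_cond.
case=> g0 /(shifts_indepP _ dN) H0.
apply: (generically_imp (fun g => proj2 (shifts_indepP (shifted Z t g) dN))).
pose W := (\max_(i in J) (#|Z i|.+1 + (t i + d i)))%N.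
apply: (generically_indep (N := W) (G := fun g (x : T * 'I_N) => shifted Z t g x.1 x.2)) => [x i|g x|].
- by apply: pol_iter_skewX => // j; apply: pol_annih.
- rewrite inE => /andP[xJ xd]; apply: leq_trans (size_iter_skewX _ _ _) _.
  rewrite size_annih -cardE.
  apply: leq_trans (leq_bigmax_cond (F := fun i => #|Z i|.+1 + (t i + d i))%N _ xJ).
  lia.
by exists g0.
Qed.

(** The first clause makes the largest degree in each member exactly $k - 1$. The second is the
    dimension count: the members in [O] all lie in the span of the $X^{t_0 + e}$ times the
    annihilator of [B], of degree less than $k$. *)
Definition admissible k (J : {set T}) (Z : T -> {set I}) (t d : T -> nat) : Prop :=
  (forall i, i \in J -> #|Z i| + t i + d i = k)%N /\
  (forall (O : {set T}) (B : {set I}) t0, O \subset J -> O != set0 ->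
     (forall i, i \in O -> (B \subset Z i) && (t0 <= t i)%N) ->
     (\sum_(i in O) d i + #|B| + t0 <= k)%N).

(** The induction measure: dropping or merging members lowers the first summand, cancelling $X$
    lowers [k], and sending a point to 0 lowers the last summand. *)
Definition weight k (J : {set T}) (Z : T -> {set I}) : nat :=
  (#|J| + k + \sum_(i in J) #|Z i|)%N.

Section Step.
Variables (k : nat) (J : {set T}) (Z : T -> {set I}) (t d : T -> nat).
Hypothesis adm : admissible k J Z t d.
Hypothesis IH : forall k' J' Z' t' d', (weight k' J' Z' < weight k J Z)%N ->
  admissible k' J' Z' t' d' ->
  generically (fun g => shifts_indep J' d' (shifted Z' t' g)).

Let goal := generically (fun g => shifts_indep J d (shifted Z t g)).

Lemma step_zero i0 : i0 \in J -> d i0 = 0%N -> goal.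
Proof.
move=> iJ di0.
have sub : J :\ i0 \subset J by apply: subsetDl.
apply: generically_imp (IH (k' := k) (J' := J :\ i0) (Z' := Z) (t' := t) (d' := d) _ _).
- move=> g H c Hc i e iJ' ed; apply: (H c) => //.
    by rewrite -[RHS]Hc [RHS](big_setD1 i0) //= di0 big_ord0 add0r.
  by rewrite !inE iJ' andbT; apply: contraTneq ed => ->; rewrite di0.
- by rewrite /weight [in X in (_ < X)%N](cardsD1 i0) iJ (big_setD1 i0 iJ) /=; lia.
split=> [i /(subsetP sub)|O B t0 OJ]; first exact: adm.1.
by apply: adm.2; apply: subset_trans OJ sub.
Qed.

Lemma annih_subset_span (A B : {set I}) g x t0 N : B \subset A -> (t0 <= x)%N ->
  (#|A| + x < #|B| + t0 + N)%N -> exists c : nat -> K,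
  iter x S (ann g (enum A)) = \sum_(e < N) c e *: iter (t0 + e) S (ann g (enum B)).
Proof.
move=> BA tx lt.
have P : perm_eq (enum A) (enum (A :\: B) ++ enum B).
  apply: uniq_perm; rewrite ?cat_uniq ?enum_uniq //=.
    by rewrite andbT; apply/hasPn => j; rewrite !mem_enum inE => ->.
  move=> j; rewrite mem_cat !mem_enum inE; case: (boolP (j \in B)) => [/(subsetP BA)->|] //.
  by rewrite orbF.
rewrite (perm_annih phiE q_gt1 alpha g P) -(subnKC tx) iterD.
have [c Hc] := annih_cat_span q phi alpha g (enum (A :\: B)) (enum B) (x - t0).
rewrite Hc -cardE; set M := (_ + _).+1.
have MN : (M <= N)%N by have := cardsID B A; rewrite (setIidPr BA) /M; lia.
(* Passing the scalars to the left of $X^{t_0}$ twists them by [phi] each time; indices from [M] on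
   are padded with 0. *)
exists (fun e => if (e < M)%N then iter t0 phi (c e) else 0).
rewrite (big_ord_widen N (fun e => c e *: iter e S (ann g (enum B))) MN).
rewrite big_mkcond /=.
have H : forall n (F : 'I_N -> {poly K}), iter n S (\sum_i F i) = \sum_i iter n S (F i).
  by elim=> //= n H F; rewrite H skewX_sum.
rewrite H; apply: eq_bigr => e _; rewrite iterD.
have HZ : forall n b p, iter n S (b *: p) = iter n phi b *: iter n S p.
  by elim=> //= n Hn b p; rewrite Hn skewXZ.
case: ifP => _; first by rewrite HZ.
rewrite scale0r; elim: (t0) => //= n ->.
by rewrite /skewX rmorph0 mulr0.
Qed.

(** By tightness, every combination of members of [O] lies in the span of a single member with data
    [B], [t0] and $D = \sum_{i \in O} d_i$. Independence of the merged family kills this combination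
    and all coefficients outside [O]; independence of [O] alone then kills the rest. *)
Lemma step_tight (O : {set T}) (B : {set I}) t0 :
  O \proper J -> (1 < #|O|)%N ->
  (forall i, i \in O -> (B \subset Z i) && (t0 <= t i)%N) ->
  (\sum_(i in O) d i + #|B| + t0 = k)%N -> goal.
Proof.
move=> OpJ O2 HO tight; have OJ := proper_sub OpJ.
have [i0 i0O] : exists i, i \in O by apply/card_gt0P; lia.
have i0J := subsetP OJ _ i0O.
pose D := (\sum_(i in O) d i)%N.
pose J' := i0 |: (J :\: O).
pose Z' i := if i == i0 then B else Z i.
pose t' i := if i == i0 then t0 else t i.
pose d' i := if i == i0 then D else d i.
have ne i : i \in J :\: O -> (i == i0) = false.
  by rewrite inE => /andP[iO _]; apply: contraNF iO => /eqP->.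
have i0D : i0 \notin J :\: O by rewrite inE i0O.
have cardJ : (#|O| < #|J|)%N by apply: proper_card.
have sumJ : (\sum_(i in J) #|Z i| = \sum_(i in O) #|Z i| + \sum_(i in J :\: O) #|Z i|)%N.
  by rewrite (big_setID O) /= (setIidPr OJ).
have g1 : generically (fun g => shifts_indep O d (shifted Z t g)).
  apply: (IH (k' := k)); first by rewrite /weight sumJ; lia.
  split=> [i /(subsetP OJ)|O' B' t0' O'O]; first exact: adm.1.
  by apply: adm.2; apply: subset_trans O'O OJ.
have g2 : generically (fun g => shifts_indep J' d' (shifted Z' t' g)).
  apply: (IH (k' := k)).
    rewrite /weight sumJ cardsU1 i0D cardsD (setIidPr OJ).
    rewrite big_setU1 //= /Z' eqxx.
    rewrite (eq_bigr (fun i => #|Z i|)); last by move=> i /ne->.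
    have := subset_leq_card (proj1 (andP (HO _ i0O))).
    rewrite (big_setD1 i0 i0O) /=; lia.
  split=> [i|O' B' s0 O'J' O'0 H].
    rewrite !inE /Z' /t' /d'; case: eqP => [-> _|_ /= /andP[_]]; last exact: adm.1.
    by rewrite /D; lia.
  have [i0O'|i0O'] := boolP (i0 \in O'); last first.
    have sub : O' \subset J :\: O.
      apply/subsetP => i iO'; have := subsetP O'J' _ iO'; rewrite in_setU1.
      by case/orP=> // /eqP ii; rewrite -ii iO' in i0O'.
    rewrite (eq_bigr d); last by move=> i /(subsetP sub)/ne; rewrite /d' => ->.
    apply: adm.2 => // [|i iO'].
      by apply: subset_trans sub (subsetDl _ _).
    by have := H i iO'; rewrite /Z' /t' (ne _ (subsetP sub _ iO')).
  have sub i : i \in O' :\ i0 -> i \in J :\: O.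
    rewrite in_setD1 => /andP[/negPf nei /(subsetP O'J')].
    by rewrite in_setU1 nei.
  (* A subfamily through the merged member is tested on the original family by putting all of [O]
     back in its place. *)
  have := adm.2 ((O' :\ i0) :|: O) B' s0; rewrite (big_setID O) /=.
  have -> : ((O' :\ i0) :|: O) :&: O = O by apply/setIidPr/subsetUr.
  have -> : ((O' :\ i0) :|: O) :\: O = O' :\ i0.
    apply/setP => i; rewrite in_setD in_setU; case: (boolP (i \in O)) => iO /=.
      by apply/esym/negP => /sub; rewrite inE iO.
    by rewrite orbF.
  have dE : (\sum_(i in O' :\ i0) d' i = \sum_(i in O' :\ i0) d i)%N.
    by apply: eq_bigr => i /sub/ne; rewrite /d' => ->.
  rewrite (big_setD1 i0 i0O') /= dE /d' eqxx.
  rewrite -/D; apply.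
  - rewrite subUset OJ andbT; apply/subsetP => i /sub; rewrite inE.
    by case/andP.
  - by apply/set0Pn; exists i0; rewrite inE i0O orbT.
  move=> i; rewrite inE => /orP[iO'|iO].
    have := H i (subsetP (subsetDl _ _) _ iO').
    by rewrite /Z' /t' (ne _ (sub _ iO')).
  have := H i0 i0O'; rewrite /Z' /t' eqxx; have := HO i iO.
  case/andP=> BZ tt /andP[B'B ss].
  by rewrite (subset_trans B'B BZ) (leq_trans ss tt).
apply: generically_imp (generically_and Kinf g1 g2) => g [ind1 ind2] c Hc.
pose inspan p := exists b : nat -> K,
  p = \sum_(e < D) b e *: iter (t0 + e) S (ann g (enum B)).
have [b Hb] : inspan (\sum_(i in O) \sum_(e < d i) c i e *: shifted Z t g i e).
  have span0 : inspan 0.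
    by exists (fun=> 0); rewrite big1 // => e _; rewrite scale0r.
  have spanD p r : inspan p -> inspan r -> inspan (p + r).
    move=> [b ->] [b' ->]; exists (fun e => b e + b' e).
    by rewrite -big_split; apply: eq_bigr => e _; rewrite scalerDl.
  apply: (big_ind inspan) => // i iO; apply: (big_ind inspan) => // e _.
  have [BZ tt] := andP (HO i iO).
  have := adm.1 i (subsetP OJ _ iO) => kE.
  have lt := ltn_ord e.
  have [|| b Hb] := @annih_subset_span (Z i) B g (t i + e) t0 D BZ.
  - by lia.
  - by move: tight; rewrite -/D; lia.
  rewrite /shifted Hb; exists (fun e' => c i e * b e').
  by rewrite scaler_sumr; apply: eq_bigr => e' _; rewrite scalerA.
pose c' i e := if i == i0 then b e else c i e.
have splitc : \sum_(i in J) \sum_(e < d i) c i e *: shifted Z t g i e =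
    \sum_(i in O) \sum_(e < d i) c i e *: shifted Z t g i e +
    \sum_(i in J :\: O) \sum_(e < d i) c i e *: shifted Z t g i e.
  by rewrite (big_setID O) /= (setIidPr OJ).
have Hc' : \sum_(i in J') \sum_(e < d' i) c' i e *: shifted Z' t' g i e = 0.
  rewrite big_setU1 //= -[RHS]Hc splitc Hb; congr (_ + _).
    by rewrite /d' /c' /shifted /Z' /t' eqxx.
  by apply: eq_bigr => i /ne nei; rewrite /d' /c' /shifted /Z' /t' nei.
have {ind2 Hc'} z2 := ind2 c' Hc'.
have b0 e : (e < D)%N -> b e = 0.
  by move=> eD; have := z2 i0 e; rewrite !inE /d' /c' eqxx; apply.
have zO : \sum_(i in O) \sum_(e < d i) c i e *: shifted Z t g i e = 0.
  by rewrite Hb big1 // => e _; rewrite b0 ?scale0r.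
move=> i e iJ ed; have [iO|iO] := boolP (i \in O); first exact: ind1 zO i e iO ed.
have iJO : i \in J :\: O by rewrite inE iO.
have := z2 i e; rewrite /d' /c' (ne _ iJO); apply=> //.
by rewrite inE iJO orbT.
Qed.

(** Only the unshifted polynomial of the one member with $t_i = 0$ can have a nonzero constant
    coefficient. Generically it does, so its scalar in a relation vanishes, and the factor $X$
    cancels from what remains, leaving a family for $k - 1$. *)
Lemma step_shift : J != set0 ->
  (forall i, i \in J -> 0 < d i)%N ->
  (forall i i', i \in J -> i' \in J -> t i = 0%N -> t i' = 0%N -> i = i') -> goal.
Proof.
move=> J0 dpos uz.
pose t' i := (t i).-1.
pose d' i := if t i == 0%N then (d i).-1 else d i.
have k0 : (0 < k)%N.
  have [i iJ] := set0Pn _ J0; have := adm.1 i iJ; have := dpos i iJ; lia.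
have g1 : generically (fun g => shifts_indep J d' (shifted Z t' g)).
  apply: (IH (k' := k.-1)); first by rewrite /weight; lia.
  split=> [i iJ|O B t0 OJ O0 H].
    have := adm.1 i iJ; have := dpos i iJ; rewrite /t' /d'.
    by case: (t i) => [|x] /=; lia.
  (* If [O] contains the member with shift 0, then [t0] is 0 and the loss of one in its [d] matches
     that in [k]; otherwise the old bound is applied with [t0.+1]. *)
  have [/existsP[i1 /andP[i1O /eqP ti1]]|nz] := boolP [exists i in O, t i == 0%N].
    have i1J := subsetP OJ _ i1O.
    have := adm.2 O B 0%N OJ O0; have := H i1 i1O; rewrite {1}/t' ti1 /= => /andP[_ t00].
    have dE : (\sum_(i in O :\ i1) d' i = \sum_(i in O :\ i1) d i)%N.
      apply: eq_bigr => i; rewrite !inE => /andP[nei iO]; rewrite /d'; case: eqP => // ti.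
      by rewrite (uz i i1) ?eqxx // ?(subsetP OJ) in nei.
    rewrite !(big_setD1 i1 i1O) /= dE /d' ti1 eqxx.
    have := dpos i1 i1J; set s := bigop _ _ _ => dd HH.
    have : (d i1 + s + #|B| + 0 <= k)%N.
      by apply: HH => i iO; have /andP[-> _] := H i iO.
    lia.
  rewrite (eq_bigr d) => [|i iO]; last first.
    rewrite /d'; case: eqP => // ti; case/existsP: nz; exists i.
    by rewrite iO ti.
  have := adm.2 O B t0.+1 OJ O0; rewrite addnS => HH.
  suff : (\sum_(i in O) d i + #|B| + t0 < k)%N by lia.
  apply: HH => i iO; have /andP[-> /=] := H i iO; rewrite /t' => le.
  have : t i != 0%N by apply: contraNneq nz => ti; apply/existsP; exists i; rewrite iO ti.
  by lia.
have g2 : generically (fun g => forall i, i \in J -> t i = 0%N -> (ann g (enum (Z i)))`_0 != 0).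
  have [/existsP[i1 /andP[i1J /eqP ti1]]|nz] := boolP [exists i in J, t i == 0%N].
    apply: generically_imp (generically_annih_coef0 phiE q_gt1 Kinf alpha_neq0 (enum_uniq (Z i1))).
    by move=> g H i iJ ti; rewrite (uz i i1).
  apply: generically_true => g i iJ ti; case/existsP: nz; exists i.
  by rewrite iJ ti.
apply: generically_imp (generically_and Kinf g1 g2) => g [ind nzc] c Hc.
have c0 i : i \in J -> t i = 0%N -> c i 0%N = 0.
  move=> iJ ti; have := congr1 (fun p : {poly K} => p`_0) Hc.
  rewrite coef0 coef_sum (big_setD1 i iJ) /= [X in _ + X]big1 => [|i']; last first.
    rewrite !inE => /andP[nei i'J]; rewrite coef_sum big1 // => e _.
    rewrite coefZ /shifted; case ti': (t i') => [|x].
      by rewrite (uz i i') ?eqxx // in nei.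
    by rewrite addSn /= coef_skewX mulr0.
  rewrite addr0 coef_sum; have := dpos i iJ; case: (d i) => // n _.
  rewrite big_ord_recl big1 => [|e _]; last first.
    by rewrite coefZ /shifted ti add0n /= coef_skewX mulr0.
  rewrite addr0 coefZ /shifted ti /= => /eqP; rewrite mulf_eq0.
  by rewrite (negPf (nzc i iJ ti)) orbF => /eqP.
(* Pulling a scalar [c] through $X$ on its left requires a preimage under [phi], which [psi]
   provides. *)
pose c' i e := psi (if t i == 0%N then c i e.+1 else c i e).
have Hc' : \sum_(i in J) \sum_(e < d' i) c' i e *: shifted Z t' g i e = 0.
  have : S (\sum_(i in J) \sum_(e < d' i) c' i e *: shifted Z t' g i e) = 0.
    rewrite -[RHS]Hc skewX_sum; apply: eq_bigr => i iJ; rewrite skewX_sum /d' /c'.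
    case: eqP => ti.
      have := dpos i iJ; case E: (d i) => [//|n] _ /=.
      rewrite big_ord_recl /= c0 // scale0r add0r; apply: eq_bigr => e _.
      by rewrite skewXZ psiK /shifted /t' ti.
    apply: eq_bigr => e _; rewrite skewXZ psiK /shifted /t' -iterS -addSn.
    by rewrite prednK // lt0n; apply/eqP.
  move=> /eqP; rewrite -size_poly_eq0 size_skewX.
  by case: ifP => [/eqP|].
have z := ind c' Hc'.
move=> i e iJ ed; have [ti|ti] := eqVneq (t i) 0%N.
  case: e ed => [|e] ed; first exact: c0.
  have := z i e iJ; rewrite /d' /c' ti eqxx => H.
  by rewrite -[LHS]psiK H ?rmorph0 //; lia.
have := z i e iJ; rewrite /d' /c' (negPf ti) => H.
by rewrite -[LHS]psiK H ?rmorph0.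
Qed.

(** Setting $g_j = 0$ turns each annihilator with $j \in Z_i$ into $X$ times that of $Z_i \setminus
    \{j\}$, moving one unit from $|Z_i|$ to $t_i$. Independence at this special choice of points is
    enough for generic independence. *)
Lemma step_specialize i0 i1 :
  (forall (O : {set T}) (B : {set I}) t0, O \proper J -> (1 < #|O|)%N ->
     (forall i, i \in O -> (B \subset Z i) && (t0 <= t i)%N) ->
     (\sum_(i in O) d i + #|B| + t0 != k)%N) ->
  (forall i, i \in J -> 0 < d i)%N ->
  i0 \in J -> i1 \in J -> i0 != i1 -> t i0 = 0%N -> t i1 = 0%N -> goal.
Proof.
move=> nt dpos i0J i1J ne01 t0 t1.
(* If $Z_{i_1} \subseteq Z_{i_0}$, admissibility of the pair with $B = Z_{i_1}$ would force $d_{i_0}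
   = 0$. *)
have [j jZ1 jZ0] : exists2 j, j \in Z i1 & j \notin Z i0.
  apply/subsetPn/negP => sub.
  have := adm.2 [set i0; i1] (Z i1) 0%N.
  rewrite big_setU1 /= ?inE // big_set1.
  have := adm.1 i1 i1J; have := dpos i0 i0J => d0 k1 H.
  suff : (d i0 + d i1 + #|Z i1| + 0 <= k)%N by lia.
  apply: H => [||i].
  - by apply/subsetP => i; rewrite !inE => /orP[] /eqP->.
  - by apply/set0Pn; exists i0; rewrite !inE eqxx.
  by rewrite !inE => /orP[] /eqP->; rewrite ?t0 ?t1 ?sub ?subxx.
pose Z' i := Z i :\ j.
pose t' i := (t i + (j \in Z i))%N.
have cardZ' i : (#|Z i| = (j \in Z i) + #|Z' i|)%N by rewrite (cardsD1 j).
have /generically_ex[g Hg] : generically (fun g => shifts_indep J d (shifted Z' t' g)).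
  apply: (IH (k' := k)).
    rewrite /weight ltn_add2l (big_setD1 i1 i1J) /= [X in (_ < X)%N](big_setD1 i1 i1J) /=.
    rewrite [X in (_ < X + _)%N]cardZ' jZ1 -addnA add1n ltnS leq_add2l.
    by apply: leq_sum => i _; rewrite [X in (_ <= X)%N]cardZ' leq_addl.
  split=> [i iJ|O B s0 OJ O0 H].
    by have := adm.1 i iJ; rewrite cardZ' /t'; lia.
  have HB i : i \in O -> B \subset Z i.
    by move=> iO; have /andP[/subset_trans-> //] := H i iO; apply: subsetDl.
  have [->|s0pos] := posnP s0.
    by apply: adm.2 => // i iO; rewrite HB.
  (* If all sets in [O] contain [j], then [j] joins [B] and [s0] drops by one. Otherwise a
     one-element [O] still has the old shift [s0], and a larger [O] satisfies the old bound with
     [s0.-1], strictly because it is not tight. Such an [O] is proper, since [i0] keeps shift 0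
     while [s0] is positive. *)
  have [allj|] := boolP [forall i in O, j \in Z i].
    have jB : j \notin B.
      have [i iO] := set0Pn _ O0; have /andP[/subsetP sub _] := H i iO.
      by apply/negP => /sub; rewrite !inE eqxx.
    have := adm.2 O (j |: B) s0.-1 OJ O0; rewrite cardsU1 jB => HH.
    suff : (\sum_(i in O) d i + (1 + #|B|) + s0.-1 <= k)%N by lia.
    apply: HH => i iO; have jZi := forall_inP allj i iO.
    rewrite subUset sub1set jZi HB //=.
    by have /andP[_] := H i iO; rewrite /t' jZi; lia.
  rewrite negb_forall_in => /exists_inP[i2 i2O ji2].
  have ti2 : (s0 <= t i2)%N.
    by have /andP[_] := H i2 i2O; rewrite /t' (negPf ji2) addn0.
  have [O1|O2] := leqP #|O| 1.
    have /eqP/cards1P[x Ox] : #|O| = 1%N by have := i2O; rewrite (cardsD1 i2) in O1 *; lia.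
    apply: adm.2 => // i iO; rewrite HB //=.
    by move: i2O iO; rewrite Ox !inE => /eqP<- /eqP->.
  have Hfit i : i \in O -> (B \subset Z i) && (s0.-1 <= t i)%N.
    move=> iO; rewrite HB //=; have /andP[_] := H i iO; rewrite /t'.
    by case: (j \in Z i) => /=; lia.
  have OpJ : O \proper J.
    rewrite properEneq OJ andbT; apply: contraTneq s0pos => OeJ.
    have := H i0; rewrite OeJ i0J => /(_ isT)/andP[_].
    by rewrite /t' t0 (negPf jZ0) leqn0 => /eqP->.
  have := nt O B s0.-1 OpJ O2 Hfit; have := adm.2 O B s0.-1 OJ O0 Hfit; lia.
apply: generically_shifts_indep.
pose g' i := if i == j then 0 else g i.
exists g' => c Hc; apply: Hg; rewrite -[RHS]Hc.
apply: eq_bigr => i iJ; apply: eq_bigr => e _; congr (_ *: _).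
rewrite /shifted /t'.
have E : ann g' (enum (Z' i)) = ann g (enum (Z' i)).
  by apply: eq_annih => x; rewrite mem_enum !inE /g' => /andP[/negPf->].
case: (boolP (j \in Z i)) => jZ; last first.
  rewrite addn0 -E /Z'; suff -> : Z i :\ j = Z i by [].
  by apply/setP => x; rewrite !inE; case: eqP => // ->; rewrite (negPf jZ).
have P : perm_eq (enum (Z i)) (j :: enum (Z' i)).
  apply: uniq_perm; rewrite /= ?enum_uniq ?mem_enum ?inE ?eqxx //.
  by move=> x; rewrite inE !mem_enum !inE; case: eqP => // ->; rewrite jZ.
rewrite (perm_annih phiE q_gt1 alpha g' P) annih0 /g' ?eqxx // -/g' E.
by rewrite -iterSr addn1 addSn.
Qed.

End Step.

Theorem generically_admissible k J Z t d : admissible k J Z t d ->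
  generically (fun g => shifts_indep J d (shifted Z t g)).
Proof.
have [n] := ubnP (weight k J Z).
elim: n k J Z t d => // n IHn k J Z t d; rewrite ltnS => le adm.
have {IHn le} IH k' J' Z' t' d' : (weight k' J' Z' < weight k J Z)%N ->
    admissible k' J' Z' t' d' ->
    generically (fun g => shifts_indep J' d' (shifted Z' t' g)).
  by move=> lt; apply: IHn; apply: leq_trans lt le.
have [J0|J0] := eqVneq J set0.
  by apply: generically_true => g c _ i e; rewrite J0 inE.
have [/exists_inP[i iJ /eqP di]|dpos] := boolP [exists i in J, d i == 0%N].
  exact: step_zero adm IH i iJ di.
have {}dpos i : i \in J -> (0 < d i)%N.
  by move=> iJ; rewrite lt0n; apply: contra dpos => di; apply/exists_inP; exists i.
have [/existsP[O /existsP[B /existsP[t0 /and4P[OpJ O2 /forall_inP HO /eqP tight]]]]|nt] :=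
  (* Tightness forces [t0] to be at most [k], so the search for a tight subfamily is finite. *)
  boolP [exists O : {set T}, exists B : {set I}, exists t0 : 'I_k.+1,
   [&& O \proper J, (1 < #|O|)%N, [forall i in O, (B \subset Z i) && (t0 <= t i)%N]
     & (\sum_(i in O) d i + #|B| + t0 == k)%N]].
  exact: step_tight adm IH O B t0 OpJ O2 HO tight.
have [/exists_inP[i0 i0J /exists_inP[i1 i1J /and3P[ne /eqP t0 /eqP t1]]]|uz] :=
  boolP [exists i0 in J, exists i1 in J, [&& i0 != i1, t i0 == 0%N & t i1 == 0%N]].
  apply: (step_specialize adm IH) ne t0 t1 => // O B s0 OpJ O2 HO.
  apply: contra nt => tight; apply/existsP; exists O; apply/existsP; exists B.
  have sk : (s0 < k.+1)%N by lia.
  apply/existsP; exists (Ordinal sk); rewrite OpJ O2 tight andbT /=.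
  exact/forall_inP.
apply: (step_shift adm IH) => // i i' iJ i'J ti ti'; apply/eqP.
apply: contraNT uz => ne; apply/exists_inP; exists i => //.
by apply/exists_inP; exists i' => //; rewrite ne ti ti'.
Qed.

End GenericIndependence.

(** * Roots of skew polynomials *)

Section SkewRoots.
Variables (K : fieldType) (q : nat) (phi : {rmorphism K -> K}).
Hypothesis phiE : forall x, phi x = x ^+ q.
Hypothesis q_gt1 : (1 < q)%N.

Local Notation ev := (skew_eval phi).

Lemma skew_eval_drop a p y :
  ev a p y = p`_0 * y + ev a (drop_poly 1 p) (semi phi a y).
Proof.
rewrite (@skew_eval_widen _ phi a p y (size p).+1) // big_ord_recl /=; congr (_ + _).
rewrite (@skew_eval_widen _ phi a _ _ (size p)); last first.
  by rewrite size_drop_poly leq_subr.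
by apply: eq_bigr => i _; rewrite coef_drop_poly addn1 -iterSr.
Qed.

(* Right division of [p] by [X - b], in terms of evaluations: for
   [p = p' X + c] one has [p = p' (X - b) + p' b + c], and [p' b] is shorter than [p]. *)
Lemma skew_right_division b (p : {poly K}) : exists (r : {poly K}) c, size r = (size p).-1 /\
  forall a y, ev a p y = ev a r (semi phi a y - b * y) + c * y.
Proof.
have [n] := ubnP (size p); elim: n p => // n IH p; rewrite ltnS => szp.
have [p0|p_neq0] := eqVneq p 0.
  exists 0, 0; rewrite p0 size_poly0; split=> // a y.
  by rewrite /skew_eval size_poly0 !big_ord0 mul0r addr0.
have sp : (0 < size p)%N by rewrite size_poly_gt0.
set p' := drop_poly 1 p.
have szp' : size p' = (size p).-1 by rewrite size_drop_poly subn1.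
pose p'' := \poly_(i < size p') (p'`_i * iter i phi b).
have szp'' : (size p'' <= size p')%N by apply: size_poly.
have lt : (size p'' < n)%N by lia.
have [r [c [szr Hr]]] := IH p'' lt.
exists (p' + r), (p`_0 + c); split.
  rewrite -szp'; have [p'0|p'_neq0] := posnP (size p').
    apply/eqP; rewrite p'0 -leqn0 (leq_trans (size_polyD _ _)) // geq_max p'0 szr.
    by lia.
  by rewrite size_polyDl // szr; lia.
move=> a y; rewrite skew_evalD skew_eval_drop -/p'.
have -> : semi phi a y = (semi phi a y - b * y) + b * y by rewrite subrK.
rewrite skew_eval_addr subrK.
suff -> : ev a p' (b * y) = ev a p'' y by rewrite Hr; ring.
rewrite (skew_eval_widen _ _ _ szp''); apply: eq_bigr => i _.
rewrite [p''`_i]coef_poly ltn_ord -mulrA; congr (_ * _).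
elim: (nat_of_ord i) => //= l ->.
by rewrite /semi rmorphM mulrCA.
Qed.

(** Here $b = a_0 y_0^{q-1}$ is chosen so that $X - b$ vanishes at the point $(a_0, y_0)$; the
    remainder is then 0. *)
Lemma skew_root_division a0 y0 (p : {poly K}) : y0 != 0 -> ev a0 p y0 = 0 ->
  exists r : {poly K}, size r = (size p).-1 /\
    forall a y, ev a p y = ev a r (semi phi a y - semi phi a0 y0 / y0 * y).
Proof.
move=> y0_neq0 p0; have [r [c [szr Hr]]] := skew_right_division (semi phi a0 y0 / y0) p.
exists r; split=> // a y; rewrite Hr.
suff -> : c = 0 by rewrite mul0r addr0.
move: p0; rewrite Hr divfK // subrr skew_eval0r add0r => /eqP.
by rewrite mulf_eq0 (negPf y0_neq0) orbF => /eqP.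
Qed.

Variables (I : finType) (alpha : I -> K).
Hypothesis alpha_neq0 : forall j, alpha j != 0.
Hypothesis alpha_conj : forall i j, sigma_conj q (alpha i) (alpha j) -> alpha i = alpha j.

Definition class_indep (B : {set I}) (beta : I -> K) : Prop :=
  forall (c : I -> K) a, (forall j, phi (c j) = c j) ->
    \sum_(j in B | alpha j == a) c j * beta j = 0 ->
    forall j, j \in B -> alpha j = a -> c j = 0.

Lemma class_indep_sub (A B : {set I}) beta :
  A \subset B -> class_indep B beta -> class_indep A beta.
Proof.
move=> AB H c a Hc sum0 j jA aj.
pose c' j := if j \in A then c j else 0.
suff : c' j = 0 by rewrite /c' jA.
apply: (H c' a) => [i||//|//]; last exact: (subsetP AB).
  by rewrite /c'; case: ifP => // _; rewrite rmorph0.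
rewrite -[RHS]sum0 (bigID (mem A)) /= [X in _ + X]big1 ?addr0.
  rewrite (eq_bigl (fun i => (i \in A) && (alpha i == a))).
    by apply: eq_bigr => i /andP[iA _]; rewrite /c' iA.
  move=> i; case iA: (i \in A); last by rewrite andbF.
  by rewrite (subsetP AB) // andbT.
by move=> i /andP[_ /negPf iA]; rewrite /c' iA mul0r.
Qed.

(** Induction on [B]: dividing by the linear factor of one point replaces each other point by its
    value under that factor. The work lies in showing that these values remain independent in each
    class. *)
Lemma skew_poly_eq0 (B : {set I}) beta (p : {poly K}) : class_indep B beta ->
  (size p <= #|B|)%N -> (forall j, j \in B -> ev (alpha j) p (beta j) = 0) -> p = 0.
Proof.
have [n] := ubnP #|B|; elim: n B beta p => // n IH B beta p; rewrite ltnS => Bn ind szp Hp.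
have [B0|[j0 j0B]] := set_0Vmem B.
  by move: szp; rewrite B0 cards0 leqn0 size_poly_eq0 => /eqP.
set y0 := beta j0; set a0 := alpha j0.
have y0_neq0 : y0 != 0.
  apply/eqP => y00; pose c j : K := (j == j0)%:R.
  have Hc j : phi (c j) = c j by rewrite rmorph_nat.
  have : c j0 = 0.
    apply: (ind c a0) => //; rewrite (bigD1 j0) ?j0B ?eqxx //= -/y0 y00 mulr0 add0r.
    by rewrite big1 // => j /andP[_ /negPf nj]; rewrite /c nj mul0r.
  by rewrite /c eqxx => /eqP; rewrite oner_eq0.
have [r [szr Hr]] := skew_root_division y0_neq0 (Hp j0 j0B).
set b := semi phi a0 y0 / y0 in Hr.
pose beta' j := semi phi (alpha j) (beta j) - b * beta j.
have cardB := cardsD1 j0 B; rewrite j0B in cardB.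
have r0 : r = 0.
  apply: (IH (B :\ j0) beta'); [by lia| |by lia|]; last first.
    by move=> j; rewrite inE => /andP[_ jB]; rewrite -Hr Hp.
  move=> c a Hc sum0 j jB aj.
  pose y := \sum_(j in B :\ j0 | alpha j == a) c j * beta j.
  have Ly : semi phi a y = b * y.
    apply/eqP; rewrite -subr_eq0 -[X in _ == X]sum0 /y /semi rmorph_sum !mulr_sumr -sumrB.
    apply/eqP; apply: eq_bigr => i /andP[_ /eqP ai].
    by rewrite rmorphM Hc /beta' /semi ai; ring.
  (* A nonzero [y] killed by the factor gives $a (y/y_0)^{q-1} = a_0$. Hence $a$ and $a_0$ are
     conjugate, so equal, and $y/y_0$ is fixed by [phi]: this is a relation among the original
     points, with coefficient [- lam] at [j0]. *)
  have [lam [Hlam yE ya]] : exists lam, [/\ phi lam = lam, y = lam * y0 & (a0 != a -> y = 0)].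
    have [->|y_neq0] := eqVneq y 0; first by exists 0; rewrite rmorph0 mul0r.
    have E : a * (y / y0) ^+ (q - 1) = a0.
      move: Ly; rewrite /b /semi !phiE !(exprq1 q_gt1) => Ly.
      have E1 : a * y ^+ (q - 1) = a0 * y0 ^+ (q - 1).
        apply: (mulIf y_neq0); transitivity (a * (y * y ^+ (q - 1))); first by ring.
        by rewrite Ly; field.
      by rewrite expr_div_n mulrA E1 mulfK // expf_neq0.
    have aa0 : a = a0.
      rewrite -aj; apply: alpha_conj; exists (y / y0); split; last by rewrite aj E.
      by rewrite mulf_neq0 ?invr_eq0.
    exists (y / y0); split; last by rewrite aa0 eqxx.
      rewrite phiE (exprq1 q_gt1); move: E; rewrite aa0 => E.
      suff -> : (y / y0) ^+ (q - 1) = 1 by rewrite mulr1.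
      by apply: (mulfI (alpha_neq0 j0)); rewrite mulr1 E.
    by rewrite divfK.
  pose c' i := if i == j0 then - lam else c i.
  have jB' : j \in B by move: jB; rewrite inE => /andP[].
  have jj0 : (j == j0) = false by move: jB; rewrite !inE => /andP[/negPf].
  suff : c' j = 0 by rewrite /c' jj0.
  apply: (ind c' a) => // [i|].
    by rewrite /c'; case: ifP => // _; rewrite rmorphN Hlam.
  have sE : \sum_(i in B | (alpha i == a) && (i != j0)) c' i * beta i = y.
    rewrite /y; apply: eq_big => [i|i /and3P[_ _ /negPf ni]].
      by rewrite !inE; case: (i \in B); case: (i == j0); rewrite ?andbF ?andbT.
    by rewrite /c' ni.
  have [aa0|naa0] := eqVneq a0 a.
    rewrite (bigD1 j0) /=; last by rewrite j0B -/a0 aa0 eqxx.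
    under eq_bigl do rewrite -andbA.
    by rewrite sE yE /c' eqxx -/y0 mulNr addNr.
  rewrite -[RHS](ya naa0) -sE; apply: eq_bigl => i; case: eqP => //= ai.
  suff -> : i != j0 by [].
  by apply: contra naa0 => /eqP ij; rewrite /a0 -ij ai.
have szp1 : (size p <= 1)%N by move: szr; rewrite r0 size_poly0; lia.
have := Hr a0 1; rewrite r0 {2}/skew_eval size_poly0 big_ord0.
rewrite (skew_eval_widen _ _ _ szp1) big_ord1 /= mulr1 => p0.
by rewrite (size1_polyC szp1) p0.
Qed.

End SkewRoots.

(** * Enlarging the zero sets to size k - 1 *)

Section SetExtension.
Variables (I T : finType) (k : nat).

Definition cap_cond (Z : T -> {set I}) : Prop := forall O : {set T}, O != set0 ->
  (#|\bigcap_(i in O) Z i| + #|O| <= k)%N.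

Definition add_to (Z : T -> {set I}) i j : T -> {set I} :=
  fun x => if x == i then j |: Z x else Z x.

(** One new element enlarges an intersection by at most one, so a violated bound was an equality
    before, and the intersection over that [O] really gained [j]. *)
Lemma cap_cond_tight Z i j : cap_cond Z -> j \notin Z i -> ~ cap_cond (add_to Z i j) ->
  exists O : {set T}, [/\ i \in O, forall x, x \in O -> x != i -> j \in Z x &
    (#|\bigcap_(x in O) Z x| + #|O| = k)%N].
Proof.
move=> HZ jZ bad.
have [/existsP[O /andP[O0 lt]]|good] := boolP [exists O : {set T},
   (O != set0) && (k < #|\bigcap_(x in O) add_to Z i j x| + #|O|)%N]; last first.
  case: bad => O O0; rewrite leqNgt; apply: contra good => lt.
  by apply/existsP; exists O; rewrite O0.
have le := HZ O O0.
have iO : i \in O.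
  apply: contraTT lt => iO; rewrite -leqNgt (eq_bigr Z) // => x xO.
  by rewrite /add_to; case: eqP => // xi; rewrite -xi xO in iO.
have sub : \bigcap_(x in O) add_to Z i j x \subset j |: \bigcap_(x in O) Z x.
  apply/subsetP => y /bigcapP Hy; rewrite in_setU1; case: eqP => //= yj.
  apply/bigcapP => x xO; have := Hy x xO; rewrite /add_to; case: ifP => // _.
  by rewrite in_setU1 => /orP[/eqP|].
have := subset_leq_card sub; rewrite cardsU1 => c1.
exists O; split=> //; last by move: c1; case: (_ \notin _) => /=; lia.
move=> x xO xi; apply: contraTT lt => jx; rewrite -leqNgt.
apply: leq_trans le; rewrite leq_add2r; apply: subset_leq_card.
apply/subsetP => y Hy; have := subsetP sub y Hy; rewrite in_setU1.
case/orP=> // /eqP yj; have /bigcapP/(_ x xO) := Hy.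
by rewrite /add_to (negPf xi) yj (negPf jx).
Qed.

(** If two candidates [j1] and [j2] both fail, their tight families meet in a tight family [O].
    Removing [i] from [O] costs one index but gains both candidates in the intersection, which
    breaks the bound. *)
Lemma cap_cond_add Z i : cap_cond Z -> (#|Z i|.+1 < k)%N -> (k <= #|I|)%N ->
  exists2 j, j \notin Z i & cap_cond (add_to Z i j).
Proof.
move=> HZ ltk kI.
have [j1 [j2 [j1Z j2Z nej]]] : exists j1 j2, [/\ j1 \notin Z i, j2 \notin Z i & j1 != j2].
  have : (1 < #|~: Z i|)%N by have := cardsC (Z i); lia.
  by case/card_gt1P=> x [y [xZ yZ ne]]; exists x, y; split=> //; rewrite -in_setC.
pose ok j := [forall O : {set T}, (O != set0) ==> (#|\bigcap_(x in O) add_to Z i j x| + #|O| <= k)%N].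
have okP j : reflect (cap_cond (add_to Z i j)) (ok j).
  apply: (iffP forallP) => H O; first by move/(implyP (H O)).
  by apply/implyP => /H.
case: (okP j1) => [|/(cap_cond_tight HZ j1Z)[O1 [iO1 HO1 t1]]]; first by exists j1.
case: (okP j2) => [|/(cap_cond_tight HZ j2Z)[O2 [iO2 HO2 t2]]]; first by exists j2.
exfalso.
set C1 := \bigcap_(x in O1) Z x in t1; set C2 := \bigcap_(x in O2) Z x in t2.
pose O := O1 :&: O2; set C := \bigcap_(x in O) Z x.
have iO : i \in O by rewrite inE iO1.
have subC : C1 :|: C2 \subset C.
  apply/subsetP => y Hy; apply/bigcapP => x; rewrite inE => /andP[x1 x2].
  by move: Hy; rewrite inE => /orP[] /bigcapP; apply.
(* Submodularity: the two equalities add up to $2k$, and the union of the families accounts for at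
   most $k$. *)
have tO : (k <= #|C| + #|O|)%N.
  have := HZ (O1 :|: O2); rewrite bigcap_setU -/C1 -/C2 => HU.
  have {}HU : (#|C1 :&: C2| + #|O1 :|: O2| <= k)%N.
    by apply: HU; apply/set0Pn; exists i; rewrite inE iO1.
  have := cardsUI C1 C2; have := cardsUI O1 O2; rewrite -/O.
  have := subset_leq_card subC; lia.
have cO := cardsD1 i O; rewrite iO in cO.
have [O'0|O'0] := eqVneq (O :\ i) set0.
  have OE : O = [set i].
    by apply/eqP; rewrite eqEsubset sub1set iO andbT -setD_eq0 O'0.
  by move: tO; rewrite /C OE big_set1 cards1; lia.
have := HZ _ O'0; set C' := \bigcap_(x in O :\ i) Z x => le.
have : j1 |: (j2 |: C) \subset C'.
  apply/subsetP => y; rewrite !inE => Hy; apply/bigcapP => x.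
  rewrite !inE => /and3P[xi x1 x2]; case/or3P: Hy => [/eqP->|/eqP->|/bigcapP].
  - exact: HO1.
  - exact: HO2.
  by apply; rewrite inE x1.
have CZ : C \subset Z i by apply: bigcap_inf.
move/subset_leq_card; rewrite !cardsU1 !inE (negPf nej) /=.
rewrite (contra (subsetP CZ j1) j1Z) (contra (subsetP CZ j2) j2Z) /=; lia.
Qed.

Lemma cap_cond_extend Z : cap_cond Z -> (k <= #|I|)%N ->
  exists Z' : T -> {set I}, [/\ forall i, Z i \subset Z' i, cap_cond Z' &
    forall i, #|Z' i|.+1 = k].
Proof.
move=> HZ kI; have [n] := ubnP (\sum_i (k - #|Z i|.+1))%N.
elim: n Z HZ => // n IH Z HZ; rewrite ltnS => le.
have leZ i : (#|Z i|.+1 <= k)%N.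
  have := HZ [set i]; rewrite big_set1 cards1 addn1; apply.
  by apply/set0Pn; exists i; rewrite inE.
have [/existsP[i lt]|ge] := boolP [exists i, #|Z i|.+1 < k]%N; last first.
  exists Z; split=> // i; apply/eqP; rewrite eqn_leq leZ leqNgt /=.
  by apply: contra ge => lt; apply/existsP; exists i.
have [j jZ Hj] := cap_cond_add HZ lt kI.
have [|Z' [sub H1 H2]] := IH _ Hj.
  apply: leq_trans le; rewrite [X in (_ < X)%N](bigD1 i) //= (bigD1 i) //=.
  rewrite (eq_bigr (fun x => k - #|Z x|.+1)%N) => [|x /negPf xi]; last first.
    by rewrite /add_to xi.
  by rewrite ltn_add2r /add_to eqxx cardsU1 jZ; lia.
exists Z'; split=> // x; apply: subset_trans (sub x); rewrite /add_to.
by case: ifP => // _; apply: subsetUr.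
Qed.

End SetExtension.

(** * Moving the evaluation points into the finite field *)

Lemma size_det_leq (R : comNzRingType) n (H : 'M[{poly R}]_n) (D : 'I_n -> nat) :
  (forall i j, size (H i j) <= (D i).+1)%N -> (size (\det H) <= (\sum_i D i).+1)%N.
Proof.
move=> HD; apply: leq_trans (size_sum _ _ _) _; apply/bigmax_leqP => s _.
rewrite mulr_sign (fun_if (fun p : {poly R} => size p)) size_polyN if_same.
apply: (big_ind2 (fun (p : {poly R}) d => size p <= d.+1)%N) => //.
  by rewrite size_poly1.
move=> p a r b pa rb; apply: leq_trans (size_polyMleq _ _) _; lia.
Qed.

Section DegreeInOnePoint.
Variables (K : fieldType) (q : nat) (phi : {rmorphism K -> K}).
Hypothesis phiE : forall x, phi x = x ^+ q.
Hypothesis q_gt1 : (1 < q)%N.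
Variables (I : finType) (alpha : I -> K).

Local Notation ann := (annih q phi alpha).

Definition upd (g : I -> K) j y : I -> K := fun i => if i == j then y else g i.

Definition annih_mx k (Z : 'I_k -> {set I}) (g : I -> K) : 'M[K]_k :=
  \matrix_(i, c) (ann g (enum (Z i)))`_c.

Lemma annih_upd g j y s : j \notin s -> ann (upd g j y) s = ann g s.
Proof.
move=> js; apply: eq_annih => i iS; rewrite /upd; case: eqP => // ij.
by rewrite -ij iS in js.
Qed.

(** With [j] permuted to the front, $g_j$ enters only through the power $q - 1$ of a linearized
    polynomial of degree at most $q^{|Z| - 1}$. *)
Lemma coef_annih_upd (Z : {set I}) g j c : exists h : {poly K},
  (size h <= (if j \in Z then (q - 1) * q ^ (#|Z| - 1) else 0).+1)%N /\
  forall y, (ann (upd g j y) (enum Z))`_c = h.[y].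
Proof.
case: (boolP (j \in Z)) => jZ; last first.
  exists ((ann g (enum Z))`_c)%:P; split=> [|y]; first exact: size_polyC_leq1.
  by rewrite annih_upd ?mem_enum // hornerC.
have P : perm_eq (enum Z) (j :: enum (Z :\ j)).
  apply: uniq_perm; rewrite /= ?enum_uniq ?mem_enum ?inE ?eqxx //.
  by move=> x; rewrite inE !mem_enum !inE; case: eqP => // ->; rewrite jZ.
set f := ann g (enum (Z :\ j)).
exists (((skewX phi f)`_c)%:P - (alpha j * f`_c) *: eval_poly q phi (alpha j) f ^+ (q - 1)).
split=> [|y]; last first.
  rewrite (perm_annih phiE q_gt1 alpha _ P) /= annih_upd ?mem_enum ?inE ?eqxx // -/f.
  rewrite {1}/upd eqxx coefB coefZ !hornerE eval_polyE //.
  by rewrite mulrAC.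
apply: leq_trans (size_polyD _ _) _; rewrite geq_max (leq_trans (size_polyC_leq1 _)) //=.
rewrite size_polyN; apply: leq_trans (size_scale_leq _ _) _.
apply: leq_trans (size_poly_exp_leq _ _) _; rewrite ltnS mulnC leq_mul2l.
apply/orP; right; have := size_eval_poly_leq phi q_gt1 (alpha j) f.
rewrite size_annih -cardE [#|Z|](cardsD1 j) jZ add1n subn1 /=.
by case: (size _).
Qed.

Lemma det_annih_upd k (Z : 'I_k -> {set I}) g j : exists h : {poly K},
  (size h <= (\sum_i if j \in Z i then (q - 1) * q ^ (#|Z i| - 1) else 0).+1)%N /\
  forall y, \det (annih_mx Z (upd g j y)) = h.[y].
Proof.
have /fin_all_exists[h Hh] (x : 'I_k * 'I_k) := coef_annih_upd (Z x.1) g j x.2.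
exists (\det (\matrix_(i, c) h (i, c))); split.
  by apply: size_det_leq => i c; rewrite mxE; have [] := Hh (i, c).
move=> y; rewrite -[RHS]/(horner_eval y _) -det_map_mx; congr (\det _).
by apply/matrixP => i c; rewrite !mxE; have [_ ->] := Hh (i, c).
Qed.

End DegreeInOnePoint.

Section Selection.
Variables (F : finFieldType) (K : fieldType) (iota : {rmorphism F -> K}).
Variables (q m n k : nat) (phi : {rmorphism K -> K}).
Hypothesis phiE : forall x, phi x = x ^+ q.
Hypothesis q_gt1 : (1 < q)%N.
Hypothesis Kinf : infinite_field K.
Variable psi : K -> K.
Hypothesis psiK : cancel psi phi.
Hypothesis cardF : #|F| = (q ^ m)%N.
Hypothesis m_gt0 : (0 < m)%N.
Hypothesis k_gt0 : (0 < k)%N.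
Hypothesis kqm : (k * q ^ (k - 1) <= q ^ m)%N.
Variable alpha : 'I_n -> K.
Hypothesis alpha_neq0 : forall j, alpha j != 0.
Variable Z : 'I_k -> {set 'I_n}.
Hypothesis Zcond : cap_cond k Z.
Hypothesis Zcard : forall i, #|Z i|.+1 = k.
Variable prev : 'I_n -> {set 'I_n}.
Hypothesis prev_lt : forall i j, i \in prev j -> (i < j)%N.
Hypothesis prev_card : forall j, (#|prev j| < m)%N.

Local Notation ann := (annih q phi alpha).
Local Notation T := (annih_mx q phi alpha Z).

(** The generic theorem with all $t_i = 0$ and $d_i = 1$, where admissibility reduces to the
    intersection condition. *)
Lemma ex_det_neq0 : exists g, \det (T g) != 0.
Proof.
have adm : admissible k [set: 'I_k] Z (fun=> 0%N) (fun=> 1%N).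
  split=> [i _|O B t0 _ O0 H]; first by rewrite -(Zcard i) addn0 addn1.
  have -> : t0 = 0%N by have [i /H/andP[_]] := set0Pn _ O0; rewrite leqn0 => /eqP.
  rewrite sum1_card addn0 addnC; apply: leq_trans (Zcond O0).
  rewrite leq_add2r; apply/subset_leq_card/bigcapsP => i /H.
  by case/andP.
have [g Hg] := generically_ex
  (generically_admissible phiE q_gt1 Kinf psiK alpha_neq0 adm).
exists g; rewrite -unitfE -[_ \is a _]/(_ \in unitmx) -row_free_unit.
apply: inj_row_free => v Hv; apply/rowP => i; rewrite mxE.
apply: (Hg (fun i _ => v 0 i) _ i 0%N) => //; apply/polyP => c.
transitivity ((\sum_i v 0 i *: ann g (enum (Z i)))`_c).
  apply: (congr1 (fun p : {poly K} => p`_c)); apply: eq_big => [x|x _]; first by rewrite inE.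
  by rewrite big_ord1.
rewrite coef_sum coef0; have [ck|kc] := ltnP c k.
  have := congr1 (fun w : 'rV_k => w 0 (Ordinal ck)) Hv; rewrite !mxE => E.
  by rewrite -[RHS]E; apply: eq_bigr => x _; rewrite coefZ !mxE.
rewrite big1 // => x _; rewrite coefZ nth_default ?mulr0 //.
by rewrite size_annih -cardE Zcard.
Qed.

(** At most $k - 1$ of the sets contain [j], since their intersection is nonempty. As $k q^{k-2} \le
    q^{m-1}$ for $k \ge 2$, the sum stays below $(q-1) q^{m-1}$, leaving room for $q^{m-1}$
    dependent values. *)
Lemma bad_points_bound j :
  (\sum_i (if j \in Z i then (q - 1) * q ^ (#|Z i| - 1) else 0) + q ^ m.-1 < q ^ m)%N.
Proof.
pose O := [set i | j \in Z i].
have cardO : (#|O| <= k - 1)%N.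
  have [->|O0] := eqVneq O set0; first by rewrite cards0.
  have := Zcond O0; suff : (0 < #|\bigcap_(i in O) Z i|)%N by lia.
  by apply/card_gt0P; exists j; apply/bigcapP => i; rewrite inE.
have -> : (\sum_i (if j \in Z i then (q - 1) * q ^ (#|Z i| - 1) else 0) =
    #|O| * ((q - 1) * q ^ (k - 2)))%N.
  rewrite -big_mkcond -sum_nat_const; apply: eq_big => [i|i _]; first by rewrite inE.
  by rewrite -(Zcard i) subSS.
move: #|O| cardO => o; move: k_gt0 kqm; rewrite -{1 3}(prednK m_gt0) expnS.
(* For $k = 1$ the truncated exponent $k - 2$ is harmless, because no set contains [j]. *)
case: (k) => [//|[|k']] _ kq cardO.
  have -> : o = 0%N by lia.
  by rewrite mul0n add0n ltn_Pmull // expn_gt0 ltnW.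
have {kq} kq : (k'.+2 * q ^ k' <= q ^ m.-1)%N.
  rewrite -(leq_pmul2l (ltnW q_gt1)); move: kq; rewrite subn1 /= expnS.
  by rewrite mulnCA.
rewrite !subSS !subn0 in cardO *.
have qk : (0 < q ^ k')%N by rewrite expn_gt0 ltnW.
have : (o * q ^ k' < q ^ m.-1)%N.
  by apply: leq_trans kq; rewrite ltn_pmul2r; lia.
rewrite mulnCA; move: (o * _)%N (q ^ m.-1)%N => a b ab.
have : ((q - 1) * a < (q - 1) * b)%N by rewrite ltn_pmul2l // subn_gt0.
by rewrite !mulnBl !mul1n; have := leq_pmull b (ltnW q_gt1); lia.
Qed.

Lemma select_points : exists beta : 'I_n -> F,
  \det (T (fun j => iota (beta j))) != 0 /\
  forall j, skew_eval phi (alpha j)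
    (ann (fun j => iota (beta j)) (enum (prev j))) (iota (beta j)) != 0.
Proof.
suff H s : (s <= n)%N -> exists g, [/\ forall j : 'I_n, (j < s)%N -> exists x, g j = iota x,
    \det (T g) != 0 &
    forall j : 'I_n, (j < s)%N -> skew_eval phi (alpha j) (ann g (enum (prev j))) (g j) != 0].
  have [g [Hg dg evg]] := H n (leqnn n).
  have /fin_all_exists[beta Hb] j : exists x, g j = iota x by apply: Hg.
  exists beta; split=> [|j].
    suff <- : T g = T (fun j => iota (beta j)) by [].
    by apply/matrixP => i c; rewrite !mxE (@eq_annih _ q phi _ alpha _ (fun j => iota (beta j))).
  rewrite -Hb -(@eq_annih _ q phi _ alpha g); first exact: evg.
  by move=> i _; apply: Hb.
elim: s => [_|s IH sn]; first by have [g] := ex_det_neq0; exists g.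
have [g [Hg dg evg]] := IH (ltnW sn).
pose j0 := Ordinal sn.
have [h [szh Hh]] := det_annih_upd phiE q_gt1 alpha Z g j0.
set e := eval_poly q phi (alpha j0) (ann g (enum (prev j0))).
have h_neq0 : h != 0.
  apply: contraNneq dg => h0; have := Hh (g j0); rewrite h0 horner0 => <-.
  apply/eqP; congr (\det _); apply/matrixP => i c; rewrite !mxE (@eq_annih _ q phi _ alpha (upd g j0 (g j0)) g) //.
  by move=> j _; rewrite /upd; case: eqP => // ->.
have e_neq0 : e != 0 by rewrite eval_poly_neq0 // monic_neq0 // annih_monic.
have sze : (size e <= (q ^ m.-1).+1)%N.
  apply: leq_trans (size_eval_poly_leq _ q_gt1 _ _) _.
  rewrite size_annih -cardE ltnS leq_exp2l //=.
  by rewrite -ltnS prednK // prev_card.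
(* The product of both conditions has degree less than the order of [F], so some element of [F] is
   not a root. *)
have szhe : (size (h * e)%R <= q ^ m)%N.
  apply: leq_trans (size_polyMleq _ _) _; apply: leq_trans (bad_points_bound j0).
  rewrite -subn1 leq_subLR add1n; apply: leq_trans (leq_add szh sze) _.
  by rewrite addSn addnS.
have [x Hx] : exists x, (h * e).[iota x] != 0.
  apply/existsP; apply: contraLR szhe => /existsPn all0; rewrite -ltnNge -cardF.
  rewrite cardE -(size_map iota); apply: max_poly_roots; rewrite ?mulf_neq0 //.
    by apply/allP => _ /mapP[x _ ->]; rewrite /root; apply: negbNE.
  by rewrite map_inj_uniq ?enum_uniq //; apply: fmorph_inj.
move: Hx; rewrite hornerM mulf_eq0 negb_or => /andP[hx ex].
(* Predecessors have smaller indices, so moving the point [s] preserves the conditions already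
   secured. *)
have annE (j : 'I_n) : (j <= s)%N -> ann (upd g j0 (iota x)) (enum (prev j)) = ann g (enum (prev j)).
  move=> js; apply: annih_upd; rewrite mem_enum; apply/negP => /prev_lt /=.
  by rewrite ltnNge js.
exists (upd g j0 (iota x)); split=> [j|| j].
- rewrite /upd; case: eqP => [_ _|ne js]; first by exists x.
  apply: Hg; rewrite ltn_neqAle -ltnS js andbT.
  by apply/eqP => E; apply: ne; apply: val_inj.
- by rewrite Hh.
rewrite ltnS => js; rewrite annE // {1}/upd; case: (j =P j0) => [->|ne].
  by rewrite -(eval_polyE phiE).
apply: evg; rewrite ltn_neqAle js andbT.
by apply/eqP => E; apply: ne; apply: val_inj.
Qed.

End Selection.

(** * Annihilators under a field embedding *)

Section Transfer.
Variables (F K : fieldType) (iota : {rmorphism F -> K}) (q : nat).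
Variables (phiF : {rmorphism F -> F}) (phiK : {rmorphism K -> K}).
Hypothesis iota_phi : forall x, iota (phiF x) = phiK (iota x).

Lemma map_skew_eval a p y : iota (skew_eval phiF a p y) =
  skew_eval phiK (iota a) (map_poly iota p) (iota y).
Proof.
rewrite /skew_eval size_map_poly rmorph_sum; apply: eq_bigr => i _.
rewrite rmorphM coef_map; congr (_ * _).
by elim: (nat_of_ord i) => //= l IH; rewrite /semi rmorphM iota_phi IH.
Qed.

Lemma map_annih (I : eqType) (a : I -> F) b s : map_poly iota (annih q phiF a b s) =
  annih q phiK (fun j => iota (a j)) (fun j => iota (b j)) s.
Proof.
elim: s => [|j s IH] /=; first by rewrite rmorph1.
rewrite rmorphB /= map_polyZ [iota (_ * _)]rmorphM rmorphXn map_skew_eval IH; congr (_ - _).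
rewrite /skewX -IH rmorphM /= map_polyX; congr (_ * _).
by rewrite -!map_poly_comp; apply: eq_map_poly => x /=; rewrite iota_phi.
Qed.

End Transfer.

(** * Linearized Reed-Solomon codes *)

Lemma frobenius_power (F : fieldType) p e : p \in [pchar F] ->
  exists phi : {rmorphism F -> F}, forall x, phi x = x ^+ (p ^ e).
Proof.
move=> chp; elim: e => [|e [phi Hphi]]; first by exists idfun => x; rewrite expr1.
exists (pFrobenius_aut chp \o phi) => x /=.
by rewrite pFrobenius_autE Hphi -exprM -expnSr.
Qed.

(** For nonconstant [h], a root of $h - 1$ is a point where [h] takes the value 1. *)
Lemma closed_infinite (K : closedFieldType) : infinite_field K.
Proof.
move=> h h_neq0; have [sz|/negP sz] := boolP (1 < size h)%N.
  have : size (h - 1) != 1%N by rewrite size_polyDl ?size_polyN ?size_poly1 // neq_ltn sz orbT.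
  case/closed_rootP=> x; rewrite /root hornerD hornerN hornerC subr_eq0 => /eqP hx.
  by exists x; rewrite hx oner_neq0.
exists 0; have /size1_polyC E : (size h <= 1)%N by rewrite leqNgt; apply/negP.
by rewrite E hornerC; apply: contraNneq h_neq0 => h0; rewrite E h0.
Qed.

Lemma closed_root_exists (K : closedFieldType) q (c : K) : (0 < q)%N ->
  exists x, x ^+ q == c.
Proof.
move=> q0; have /closed_rootP[x] : size ('X^q - c%:P) != 1%N.
  by rewrite size_XnsubC // eqSS -lt0n.
by rewrite /root !hornerE subr_eq0 => Hx; exists x; move: Hx; rewrite ?hornerXn.
Qed.

Section Blocks.
Variables (ell n : nat) (n_ : 'I_ell -> nat).

Lemma in_block_exists : (\sum_(l < ell) n_ l)%N = n ->
  forall j : 'I_n, exists l, in_block n_ l j.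
Proof.
move=> sum_n j.
have ell0 : (0 < ell)%N.
  rewrite lt0n; apply/eqP => ell0.
  suff : (n <= 0)%N by have := ltn_ord j; lia.
  by rewrite -sum_n big1 // => -[l lt]; exfalso; rewrite ell0 in lt.
have lt0 : (ell.-1 < ell)%N by rewrite prednK.
pose P (l : 'I_ell) := (j < \sum_(r < ell | (r <= l)%N) n_ r)%N.
have P0 : P (Ordinal lt0).
  rewrite /P /= (eq_bigl xpredT) ?sum_n // => r.
  by rewrite -ltnS prednK ?ltn_ord.
case: (@arg_minnP _ (Ordinal lt0) P val P0) => l Pl lmin; exists l.
rewrite /in_block -/(P l) Pl andbT leqNgt; apply/negP => lt.
have l0 : (0 < l)%N.
  rewrite lt0n; apply: contraTneq lt => l0; rewrite -leqNgt.
  by rewrite big_pred0 // => r; rewrite l0.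
have lt1 : (l.-1 < ell)%N by apply: leq_ltn_trans (leq_pred _) (ltn_ord l).
have := lmin (Ordinal lt1); rewrite /P /= => H.
have : (l <= l.-1)%N; last by lia.
by apply: H; rewrite (eq_bigl (fun r : 'I_ell => r < l)%N) // => r; rewrite -ltnS prednK.
Qed.

Lemma in_block_inj l l' j : in_block n_ l j -> in_block n_ l' j -> l = l'.
Proof.
have H (a b : 'I_ell) : in_block n_ a j -> in_block n_ b j -> (b <= a)%N.
  move=> /andP[_ ja] /andP[jb _]; rewrite leqNgt; apply/negP => ab.
  suff : (\sum_(r < ell | (r <= a)%N) n_ r <= \sum_(r < ell | (r < b)%N) n_ r)%N by lia.
  rewrite [X in (_ <= X)%N](bigID (fun r : 'I_ell => r <= a)%N) /=.
  rewrite (eq_bigl (fun r : 'I_ell => (r < b) && (r <= a))%N) ?leq_addr // => r.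
  by apply/esym/andb_idl => ra; apply: leq_ltn_trans ra ab.
by move=> Hl Hl'; apply/val_inj/eqP; rewrite eqn_leq !H.
Qed.

Definition block_before (l : 'I_ell) (j : 'I_n) : {set 'I_n} :=
  [set i : 'I_n | in_block n_ l i && (i < j)%N].

Lemma card_block_before l (j : 'I_n) : in_block n_ l j -> (#|block_before l j| < n_ l)%N.
Proof.
case/andP; set a := (\sum_(r < ell | _) _)%N => aj.
have -> : (\sum_(r < ell | (r <= l)%N) n_ r = n_ l + a)%N.
  rewrite (bigD1 l) //=; congr (_ + _)%N; apply: eq_bigl => r.
  by rewrite ltn_neqAle andbC.
move=> jb; suff : (#|block_before l j| <= j - a)%N by lia.
rewrite cardE -(size_map val) -(size_iota a (j - a)); apply: uniq_leq_size.
  by rewrite map_inj_uniq ?enum_uniq //; apply: val_inj.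
move=> _ /mapP[i + ->]; rewrite mem_enum inE => /andP[/andP[ai _] ij].
by rewrite mem_iota subnKC // ai.
Qed.

End Blocks.

Lemma Nq_semi (F : fieldType) q (phi : {rmorphism F -> F}) i a :
  (forall x, phi x = x ^+ q) -> (1 < q)%N -> Nq q i a = iter i (semi phi a) 1.
Proof.
move=> phiE q1; have -> : Nq q i a = a ^+ (\sum_(j < i) q ^ j)%N.
  by rewrite /Nq !subn1 predn_exp mulKn // -subn1 subn_gt0.
elim: i => [|i IH] /=; first by rewrite big_ord0.
rewrite -IH /semi phiE -exprM -exprS big_ord_recl expn0 add1n; congr (_ ^+ _.+1).
by rewrite big_distrl; apply: eq_bigr => j _ /=; rewrite expnSr.
Qed.

Section Code.
Variables (F : fieldType) (q k ell n : nat) (n_ : 'I_ell -> nat).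
Variables (phi : {rmorphism F -> F}) (a : 'I_ell -> F) (beta : 'I_n -> F).
Hypothesis phiE : forall x, phi x = x ^+ q.
Hypothesis q_gt1 : (1 < q)%N.
Variable blk : 'I_n -> 'I_ell.
Hypothesis blkP : forall j, in_block n_ (blk j) j.

Let alpha j := a (blk j).

Lemma in_blockE l (j : 'I_n) : in_block n_ l j = (blk j == l).
Proof. by apply/idP/eqP => [H|<- //]; apply: in_block_inj (blkP j) H. Qed.

Lemma LRS_matrixE i j :
  LRS_matrix q k n_ a beta i j = iter i (semi phi (alpha j)) (beta j).
Proof.
rewrite mxE (big_pred1 (blk j)) => [|l]; last by rewrite in_blockE eq_sym.
by rewrite (Nq_semi _ _ phiE) // [RHS](semi_iterE phiE).
Qed.

Lemma LRS_matrix_eval m (D : 'M_(m, k)) r j :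
  (D *m LRS_matrix q k n_ a beta) r j =
  skew_eval phi (alpha j) (\poly_(i < k) (if insub i is Some i' then D r i' else 0)) (beta j).
Proof.
rewrite mxE (skew_eval_widen _ _ _ (size_poly _ _)); apply: eq_bigr => i _.
by rewrite LRS_matrixE coef_poly ltn_ord valK.
Qed.

Hypothesis par : LRS_params q n_ a beta.

Lemma LRS_alpha_neq0 j : alpha j != 0.
Proof. by case: par => a_neq0 _; apply: a_neq0. Qed.

Lemma LRS_rep_inj : injective a.
Proof.
have [a0 [nc _]] := par; move=> l l' E; apply/eqP; apply/negPn/negP => /nc; apply.
by exists 1; rewrite oner_neq0 expr1n mulr1.
Qed.

Lemma LRS_alpha_conj i j : sigma_conj q (alpha i) (alpha j) -> alpha i = alpha j.
Proof.
have [_ [nc _]] := par; rewrite /alpha.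
by have [->|ne] := eqVneq (blk i) (blk j) => // /nc.
Qed.

Lemma LRS_class_indep : class_indep phi alpha [set: 'I_n] beta.
Proof.
have [_ [_ bi]] := par; move=> c b Hc sum0 j _ aj.
apply: (bi (blk j) c) => // [i|]; first by rewrite /in_Fq -phiE Hc.
rewrite -[RHS]sum0; apply: eq_bigl => i.
by rewrite in_blockE inE /= -aj (inj_eq LRS_rep_inj).
Qed.

(** The maximum distance property, from the bound on the roots of a skew polynomial. *)
Lemma LRS_row_eq0 (v : 'rV_k) (C : {set 'I_n}) : (k <= #|C|)%N ->
  (forall j, j \in C -> (v *m LRS_matrix q k n_ a beta) 0 j = 0) -> v = 0.
Proof.
move=> kC Hv.
have p0 := skew_poly_eq0 phiE q_gt1 LRS_alpha_neq0 LRS_alpha_conj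
  (class_indep_sub (subsetT C) LRS_class_indep) (leq_trans (size_poly _ _) kC).
apply/rowP => i; rewrite mxE.
have /polyP/(_ i) := p0 _ (fun j jC => etrans (esym (LRS_matrix_eval v 0 j)) (Hv j jC)).
by rewrite coef_poly ltn_ord valK coef0.
Qed.

Lemma LRS_row_free : (k <= n)%N -> row_free (LRS_matrix q k n_ a beta).
Proof.
move=> kn; apply: inj_row_free => v Hv; apply: (@LRS_row_eq0 v [set: 'I_n]).
  by rewrite cardsT card_ord.
by move=> j _; rewrite Hv mxE.
Qed.

(** Pad the common zeros [B] with a set [A] of further columns to at least [k]. A combination of the
    rows in [O] that vanishes on [A] vanishes on all of these, so is 0; thus the rows of the
    submatrix on [O] and [A] are independent, and $|O| \le |A|$. *)
Lemma LRS_zero_pattern_cond (G : 'M_(k, n)) (Z : 'I_k -> {set 'I_n}) : (k <= n)%N ->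
  generator_of G (LRS_matrix q k n_ a beta) ->
  (forall i j, j \in Z i -> G i j = 0) -> cap_cond k Z.
Proof.
move=> kn /andP[Gfree /andP[/submxP[D GE] _]] Gz O O0.
set B := \bigcap_(i in O) Z i.
pose A := [set x in take (k - #|B|) (enum (~: B))].
have cardA : #|A| = (k - #|B|)%N.
  rewrite cardsE (card_uniqP _) ?take_uniq ?enum_uniq // size_take -cardE.
  have := cardsC B; rewrite card_ord; case: ltnP; lia.
have AB : [disjoint B & A].
  rewrite disjoint_sym disjoint_subset; apply/subsetP => x; rewrite inE => /mem_take.
  by rewrite mem_enum in_setC.
pose H := \matrix_(r < #|O|, s < #|A|) G (enum_val r) (enum_val s).
suff : row_free H.
  (* The subtraction in $|A| = k - |B|$ is truncated; $|O| > 0$ excludes the case $|B| \ge k$. *)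
  rewrite /row_free => /eqP rkH; have := rank_leq_col H; rewrite rkH cardA.
  suff : (0 < #|O|)%N by lia.
  by rewrite card_gt0.
apply: inj_row_free => w wH.
pose E := \matrix_(r < #|O|, i < k) (enum_val r == i)%:R : 'M[F]_(#|O|, k).
have wEG j : (w *m E *m G) 0 j = \sum_r w 0 r * G (enum_val r) j.
  rewrite -mulmxA mxE; apply: eq_bigr => r _; congr (_ * _).
  rewrite mxE (bigD1 (enum_val r)) //= mxE eqxx mul1r big1 ?addr0 // => i ne.
  by rewrite mxE eq_sym (negPf ne) mul0r.
have : w *m E *m D = 0.
  apply: (@LRS_row_eq0 _ (B :|: A)).
    by rewrite cardsU (disjoint_setI0 AB) cards0 cardA; lia.
  move=> j; rewrite -mulmxA -GE wEG inE => /orP[jB|jA].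
    rewrite big1 // => r _; rewrite Gz ?mulr0 //.
    by move/bigcapP: jB; apply; apply: enum_valP.
  have := congr1 (fun u : 'rV_ #|A| => u 0 (enum_rank_in jA j)) wH.
  rewrite !mxE => {2}<-; apply: eq_bigr => r _.
  by rewrite mxE enum_rankK_in.
move/(congr1 (mulmx^~ (LRS_matrix q k n_ a beta))); rewrite mul0mx -mulmxA -GE => /eqP.
rewrite mulmx_free_eq0 // => /eqP wE; apply/rowP => r.
have := congr1 (fun u : 'rV_k => u 0 (enum_val r)) wE; rewrite !mxE.
rewrite (bigD1 r) //= mxE eqxx mulr1 big1 ?addr0 // => s ne.
by rewrite mxE (inj_eq enum_val_inj) (negPf ne) mulr0.
Qed.

End Code.

(** The first powers of a primitive element [w]. Raising to the norm exponent $M = (q^m - 1)/(q -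
    1)$ removes the factor $c^{q-1}$, and the powers of $w^M$ with exponents below $q - 1$ are
    distinct. *)
Lemma conj_class_reps (F : finFieldType) q m ell : (1 < q)%N -> #|F| = (q ^ m)%N ->
  (0 < m)%N -> (ell <= q - 1)%N -> exists a : 'I_ell -> F,
  (forall l, a l != 0) /\ (forall l l', l != l' -> ~ sigma_conj q (a l) (a l')).
Proof.
move=> q_gt1 cardF m_gt0 ellq; pose N := #|F|.-1.
have cF : (1 < #|F|)%N by apply: finNzRing_gt1.
have N0 : (0 < N)%N by rewrite /N; lia.
have cN : #|F| = N.+1 by rewrite /N; lia.
have expN (x : F) : x != 0 -> x ^+ N = 1.
  by move=> x0; apply: (mulfI x0); rewrite -exprS -cN expf_card mulr1.
have /hasP[w _ prim] : has N.-primitive_root (enum (predC1 (0 : F))).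
  apply: has_prim_root => //; rewrite ?enum_uniq //.
    apply/allP => x; rewrite mem_enum !inE => x0.
    by rewrite unity_rootE expN.
  by rewrite -cardE cardC1.
have w0 : w != 0.
  apply: contraTneq (oner_neq0 F) => w0.
  by rewrite negbK -(prim_expr_order prim) w0 expr0n gtn_eqF.
exists (fun l => w ^+ l); split=> [l|l l' ne [c [c0 E]]]; first exact: expf_neq0.
pose M := (\sum_(j < m) q ^ j)%N.
have NM : N = ((q - 1) * M)%N by rewrite /N cardF predn_exp subn1.
have M0 : (0 < M)%N by move: N0; rewrite NM muln_gt0 => /andP[].
move/(congr1 (fun x => x ^+ M)): E.
rewrite exprMn -(exprM c) -NM expN // mulr1 -!exprM => /eqP.
rewrite (eq_prim_root_expr prim) NM -!(mulnC M) -!muln_modr eqn_pmul2l //.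
rewrite !modn_small; [|by apply: leq_trans (ltn_ord _) ellq..].
by move/eqP/val_inj => E; rewrite E eqxx in ne.
Qed.

(** In a relation, take the last index with nonzero coefficient and apply the annihilator of the
    earlier points of the block: only that term survives. *)
Lemma eval_prev_indep (F : fieldType) q (phi : {rmorphism F -> F}) ell n
    (n_ : 'I_ell -> nat) (a beta : 'I_n -> F) (l : 'I_ell) :
  (forall x, phi x = x ^+ q) -> (1 < q)%N ->
  (forall i j : 'I_n, in_block n_ l i -> in_block n_ l j -> a i = a j) ->
  (forall j : 'I_n, in_block n_ l j ->
     skew_eval phi (a j) (annih q phi a beta (enum (block_before n_ l j))) (beta j) != 0) ->
  block_Fq_indep q n_ beta l.
Proof.
move=> phiE q_gt1 ca Hev c Hc sum0 j0 j0l; apply/eqP/negPn/negP => cj0.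
pose P (j : 'I_n) := in_block n_ l j && (c j != 0).
have P0 : P j0 by rewrite /P j0l.
case: (@arg_maxnP _ j0 P val P0) => j /andP[jl cj] jmax.
set f := annih q phi a beta (enum (block_before n_ l j)).
have : skew_eval phi (a j) f (\sum_(i < n | in_block n_ l i) c i * beta i) = 0.
  by rewrite sum0 skew_eval0r.
rewrite (big_morph _ (skew_eval_addr phi (a j) f) (skew_eval0r phi (a j) f)).
have cfix i : phi (c i) = c i by rewrite phiE; apply/eqP/Hc.
rewrite (bigD1 j) //= big1 ?addr0 => [|i /andP[il ij]].
  rewrite skew_eval_scaler // => /eqP; rewrite mulf_eq0 (negPf cj) /=.
  exact/negP/Hev.
rewrite skew_eval_scaler //; have [->|ci] := eqVneq (c i) 0; first by rewrite mul0r.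
rewrite (ca j i) // annih_root ?mulr0 // mem_enum inE il ltn_neqAle.
by rewrite val_eqE ij; apply: jmax; rewrite /P il.
Qed.

Theorem mainTheorem1 (q m ell n k : nat) (F : finFieldType)
  (n_ : 'I_ell -> nat) (Z : 'I_k -> {set 'I_n}) :
  prime_power q ->
  #|F| = (q ^ m)%N ->
  (0 < ell)%N -> (0 < m)%N -> (0 < n)%N ->
  (1 <= k <= n)%N ->
  (ell <= q - 1)%N ->
  (forall l, 0 < n_ l)%N ->
  (\sum_(l < ell) n_ l)%N = n ->
  (ell.+1 <= q)%N ->
  (* m >= k - 1 + log_q k, i.e. k * q^(k-1) <= q^m *)
  (k * q ^ (k - 1) <= q ^ m)%N ->
  (forall l, n_ l <= m)%N ->
  (exists (a : 'I_ell -> F) (beta : 'I_n -> F),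
      LRS_params q n_ a beta /\
      exists G : 'M[F]_(k, n),
        generator_of G (LRS_matrix q k n_ a beta) /\
        forall (i : 'I_k) (j : 'I_n), j \in Z i -> G i j = 0)
  <->
  (forall Omega : {set 'I_k}, Omega != set0 ->
     (#|\bigcap_(i in Omega) Z i| + #|Omega| <= k)%N).
Proof.
move=> [p [e [p_pr [e_gt0 qE]]]] cardF ell_gt0 m_gt0 n_gt0 /andP[k_gt0 kn] ellq _ sum_n _ kqm nm.
have q_gt1 : (1 < q)%N by rewrite qE -(exp1n e) ltn_exp2r ?prime_gt1.
have chF : p \in [pchar F].
  by apply: (card_finPcharP (n := (e * m)%N)) => //; rewrite cardF qE expnM.
have [phi] := frobenius_power e chF; rewrite -qE => phiE.
have /fin_all_exists[blk blkP] := in_block_exists sum_n.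
split=> [[a [beta [par [G [gen Gz]]]]]|cond].
  exact: (LRS_zero_pattern_cond phiE q_gt1 blkP par kn gen Gz).
have [Z' [subZ condZ' cardZ']] : exists Z' : 'I_k -> {set 'I_n},
    [/\ forall i, Z i \subset Z' i, cap_cond k Z' & forall i, #|Z' i|.+1 = k].
  by apply: cap_cond_extend => //; rewrite card_ord.
have [a [a_neq0 a_conj]] := conj_class_reps q_gt1 cardF m_gt0 ellq.
(* The generic argument takes place over an infinite field in which $q$-th roots exist. *)
have [K [iota _]] := countable_algebraic_closure F.
have chK : p \in [pchar K] by rewrite (fmorph_pchar iota).
have [phiK] := frobenius_power e chK; rewrite -qE => phiKE.
have rootK c := @closed_root_exists K q c (ltnW q_gt1).
pose psi c := xchoose (rootK c).
have psiK : cancel psi phiK by move=> c; rewrite phiKE; apply/eqP/(xchooseP (rootK c)).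
pose alpha j := a (blk j).
have alphaK_neq0 j : iota (alpha j) != 0 by rewrite fmorph_eq0 a_neq0.
pose prev j := block_before n_ (blk j) j.
have prev_lt i j : i \in prev j -> (i < j)%N by rewrite inE => /andP[].
have prev_card j : (#|prev j| < m)%N.
  exact: leq_trans (card_block_before (blkP j)) (nm _).
have [beta [dT evb]] := select_points iota phiKE q_gt1 (@closed_infinite K) psiK cardF m_gt0 k_gt0
  kqm alphaK_neq0 condZ' cardZ' prev_lt prev_card.
have iota_phi x : iota (phi x) = phiK (iota x) by rewrite phiE phiKE rmorphXn.
have blkE := in_blockE blkP.
have par : LRS_params q n_ a beta.
  split=> //; split=> // l.
  apply: (eval_prev_indep (a := alpha) phiE q_gt1) => [i j|j].
    by rewrite !blkE /alpha => /eqP-> /eqP->.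
  rewrite blkE => /eqP<-; rewrite -(fmorph_eq0 iota).
  by rewrite (map_skew_eval iota_phi) (map_annih _ iota_phi); apply: evb.
exists a, beta; split=> //.
(* [T] is the change of basis from the defining matrix to the generator matrix: its row [i] holds
   the coefficients of the annihilator of [Z' i]. *)
pose T := annih_mx q phi alpha Z' beta.
have Tunit : T \in unitmx.
  rewrite unitmxE unitfE -(fmorph_eq0 iota) -det_map_mx.
  apply: contraNneq dT => dT; rewrite -[X in _ == X]dT; apply/eqP; congr (\det _).
  by apply/matrixP => i c; rewrite !mxE -(map_annih _ iota_phi) coef_map.
have eqG : (T *m LRS_matrix q k n_ a beta :=: LRS_matrix q k n_ a beta)%MS.
  by apply: eqmxMfull; rewrite row_full_unit.
exists (T *m LRS_matrix q k n_ a beta); split.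
  apply/andP; split; last by apply/eqmxP.
  by rewrite /row_free eqG -/(row_free _) (LRS_row_free phiE q_gt1 blkP).
move=> i j jZ; rewrite (LRS_matrix_eval a beta phiE q_gt1 blkP).
have jZ' : j \in enum (Z' i) by rewrite mem_enum (subsetP (subZ i)).
rewrite -[RHS](annih_root phiE q_gt1 alpha beta jZ'); congr (skew_eval _ _ _ _).
(* The annihilator has size exactly [k], so keeping [k] coefficients loses nothing. *)
apply/polyP => c; rewrite coef_poly; case: ltnP => [ck|kc].
  by rewrite insubT mxE.
by rewrite nth_default // size_annih -cardE cardZ'.
Qed.
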